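(* Let $\mathbb{P}$ be an ergodic, $T$-invariant environment measure on $\Omega$ of finite range $M$, and let $\ell\in\mathbb{R}^d\setminus\{0\}$. Let $\omega_{\not 0}=(\omega_y)_{y\ne0}$, let $Q_{\omega_{\not0}}$ be the regular conditional distribution under $\mathbb{P}$ of $\omega_0$ given $\omega_{\not0}$, let $Q_0$ be the marginal law of $\omega_0$ and $Q_{\not0}$ the marginal law of $\omega_{\not0}$. Suppose that $Q_{\omega_{\not0}}\ll Q_0$ for $Q_{\not0}$-almost every $\omega_{\not0}$, and that there exist constants $A,B$ such that for $Q_0\otimes Q_{\not0}$-almost every $(\omega_0,\omega_{\not0})$, $$0<A\le\frac{dQ_{\omega_{\not0}}}{dQ_0}(\omega_0)\le B<\infty.$$ Suppose moreover that there is $\kappa\in(0,1)$ with $\mathbb{P}(\pi_{ij}>\kappa\text{ whenever }|i-j|\le M)=1$, and that $$\mathbb{E}\big((D\cdot\ell)^+\big)>\kappa^{-1}BA^{-1}\,\mathbb{E}\big((D\cdot\ell)^-\big).$$ Then Kalikow's condition in direction $\ell$ holds, i.e. $$\inf_{U}\inf_{x\in U}\frac{E_0\big(\sum_{j=0}^{T_U}\mathbf 1(X_j=x)\,D(T^{X_j}\omega)\cdot\ell\big)}{E_0\big(\sum_{j=0}^{T_U}\mathbf 1(X_j=x)\big)}>0,$$ where $T_U=\inf\{j\ge0:X_j\notin U\}$ and $U$ ranges over all finite $M$-connected subsets of $\mathbb{Z}^d$ containing $0$.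
   Context: Let $d\ge1$ and let $|\cdot|$ be the Euclidean norm. An environment is $\omega=(\omega_{ij})_{i,j\in\mathbb{Z}^d}\in[0,1]^{\mathbb{Z}^d\times\mathbb{Z}^d}$ with $\sum_j\omega_{ij}=1$ for all $i$; write $\pi_{ij}(\omega)=\omega_{ij}$ and $\omega_i=(\omega_{ij})_{j}$. $\Omega$ is the space of all environments with the product $\sigma$-field $\mathfrak{S}$, and shifts $(T^k\omega)_{ij}=\omega_{k+i,k+j}$, $k\in\mathbb{Z}^d$. An environment measure $\mathbb{P}$ is a probability measure on $(\Omega,\mathfrak{S})$, with expectation $\mathbb{E}$; it is $T$-invariant and ergodic if it is so under the group $(T^k)_{k\in\mathbb{Z}^d}$; it has finite range $M$ ($1\le M<\infty$) if $\mathbb{P}(\pi_{ij}=0\text{ when }|i-j|>M)=1$. The quenched law $P_x^\omega$ is the law of the Markov chain $(X_n)_{n\ge0}$ on $\mathbb{Z}^d$ with $X_0=x$ and $P_x^\omega(X_{n+1}=j\mid X_n=i)=\pi_{ij}(\omega)$. The annealed law is $P_x=\int P_x^\omega\,d\mathbb{P}(\omega)$ (also regarded as the joint law of $(\omega,(X_n))$), with expectation $E_x$. The drift is $D(\omega)=\sum_i i\,\pi_{0i}(\omega)$; $a^+=\max(a,0)$, $a^-=\max(-a,0)$. A set $U\subset\mathbb{Z}^d$ is $M$-connected if there is a path inside $U$ with steps of norm at most $M$ passing through all its points. *)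

(* Defs.v *)
From HB Require Import structures.
From mathcomp Require Import all_boot all_order all_algebra.
From mathcomp Require Import all_classical all_reals all_analysis.
From mathcomp Require Import measurable_realfun.

Set Implicit Arguments.
Unset Strict Implicit.
Unset Printing Implicit Defensive.

Import Order.TTheory GRing.Theory Num.Theory.

Local Open Scope classical_set_scope.
Local Open Scope charge_scope.
Local Open Scope ring_scope.

Definition lattice (d : nat) := 'rV[int]_d.

HB.instance Definition _ d := GRing.Zmodule.on (lattice d).
HB.instance Definition _ d := Countable.on (lattice d).
HB.instance Definition _ d := isPointed.Build (lattice d) 0.

Definition coord d (x : lattice d) (k : 'I_d) : int := x ord0 k.

Section EuclideanGeometry.
Context {R : realType} {d : nat}.

Definition dot (u v : 'rV[R]_d) : R := \sum_(k < d) u ord0 k * v ord0 k.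

Definition lattice_norm (x : lattice d) : R :=
  Num.sqrt (\sum_(k < d) (coord x k)%:~R ^+ 2).

(* The path may revisit points. Only finite sets can satisfy this, which are the
   only ones Kalikow's condition ranges over. *)
Definition M_connected (M : R) (U : set (lattice d)) :=
  exists s : seq (lattice d),
    [set` s] = U /\ sorted (fun x y => lattice_norm (y - x) <= M) s.

(* Sum over the lattice, meaningful for absolutely summable families: [esum] is
   a supremum of finite sums, so the two signs are summed separately. *)
Definition lattice_sum (f : lattice d -> R) : R :=
  fine (\esum_(i in [set: lattice d]) (f^\+ i)%:E)
  - fine (\esum_(i in [set: lattice d]) (f^\- i)%:E).

End EuclideanGeometry.

Section ProbabilityVectors.
Variables (R : realType) (d : nat).

Record prob_vector := ProbVector {
  weight :> lattice d -> R ;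
  weight_itv : forall j, 0 <= weight j <= 1 ;
  weight_sum1 : (\esum_(j in [set: lattice d]) (weight j)%:E = 1)%E }.

Definition dirac_weight (j : lattice d) : R := (j == 0)%:R.

Fact dirac_itv j : 0 <= dirac_weight j <= 1.
Proof. by rewrite /dirac_weight; case: eqP; rewrite ?ler01 ?lexx. Qed.

Fact dirac_sum1 :
  (\esum_(j in [set: lattice d]) (dirac_weight j)%:E = 1)%E.
Proof.
rewrite (esumID [set 0])//; last first.
  by move=> j _; rewrite lee_fin; case/andP: (dirac_itv j).
rewrite !setTI esum_set1; last first.
  by rewrite lee_fin; case/andP: (dirac_itv 0).
rewrite esum1; first by rewrite /dirac_weight eqxx adde0.
by move=> j /= /eqP/negbTE; rewrite /dirac_weight => ->.
Qed.

HB.instance Definition _ := gen_eqMixin prob_vector.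
HB.instance Definition _ := gen_choiceMixin prob_vector.
HB.instance Definition _ :=
  isPointed.Build prob_vector (ProbVector dirac_itv dirac_sum1).

Definition prob_vector_cylinders : set (set prob_vector) :=
  \bigcup_(j in [set: lattice d])
    preimage_set_system setT (fun p : prob_vector => p j) measurable.

Definition prob_row := g_sigma_algebraType prob_vector_cylinders.

End ProbabilityVectors.

Definition product_cylinders (I T : Type) (G : set (set T)) :
    set (set (I -> T)) :=
  \bigcup_(i in [set: I]) preimage_set_system setT (fun w => w i) G.

Section Environments.
Variables (R : realType) (d : nat).

Definition env := g_sigma_algebraType
  (@product_cylinders (lattice d) (prob_row R d) measurable).

Definition env_off0 := g_sigma_algebraType
  (@product_cylinders {y : lattice d | y != 0} (prob_row R d) measurable).

(* On the countable state space all sets are measurable. *)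
Definition trajectory := g_sigma_algebraType
  (@product_cylinders nat (lattice d) setT).

Definition row_at0 (w : env) : prob_row R d := w 0.

Definition rows_off0 (w : env) : env_off0 := fun y => w (val y).

Fact measurable_row_at0 : measurable_fun [set: env] row_at0.
Proof.
move=> _ A mA; apply: sub_sigma_algebra; exists 0 => //.
by exists A.
Qed.

Fact measurable_rows_off0 : measurable_fun [set: env] rows_off0.
Proof.
apply: measurability; first exact: erefl.
move=> _ [_ [y _ [A mA <-]] <-]; rewrite !setTI.
apply: sub_sigma_algebra; exists (val y) => //.
by exists A; rewrite // setTI.
Qed.

HB.instance Definition _ :=
  isMeasurableFun.Build _ _ env (prob_row R d) row_at0 measurable_row_at0.
HB.instance Definition _ :=
  isMeasurableFun.Build _ _ env env_off0 rows_off0 measurable_rows_off0.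

End Environments.
Arguments row_at0 {R d}.
Arguments rows_off0 {R d}.

Section Shift.
Context {R : realType} {d : nat}.

Definition jump (w : env R d) (i j : lattice d) : R := weight (w i) j.

Fact shift_itv (w : env R d) k i j : 0 <= jump w (k + i) (k + j) <= 1.
Proof. exact: weight_itv. Qed.

Fact shift_sum1 (w : env R d) k i :
  (\esum_(j in [set: lattice d]) (jump w (k + i) (k + j))%:E = 1)%E.
Proof.
rewrite -(weight_sum1 (w (k + i))).
rewrite [RHS](reindex_esum [set: lattice d] setT (fun j => k + j)) //.
Qed.

Definition env_shift (k : lattice d) (w : env R d) : env R d :=
  fun i => ProbVector (shift_itv w k i) (shift_sum1 w k i).

Definition drift (w : env R d) : 'rV[R]_d :=
  \row_k lattice_sum (fun i : lattice d => (coord i k)%:~R * jump w 0 i).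

End Shift.

Section EnvironmentMeasures.
Context {R : realType} {d : nat}.
Implicit Type P : probability (env R d) R.

Definition shift_invariant P :=
  forall (k : lattice d) (A : set (env R d)), measurable A ->
    P (env_shift k @^-1` A) = P A.

Definition shift_ergodic P :=
  forall A : set (env R d), measurable A ->
    (forall k : lattice d, env_shift k @^-1` A = A) -> P A = 0%E \/ P A = 1%E.

Definition finite_range P (M : R) :=
  P [set w | forall i j, M < lattice_norm (i - j) -> jump w i j = 0] = 1%E.

Definition elliptic P (M kappa : R) :=
  P [set w | forall i j, lattice_norm (i - j) <= M -> kappa < jump w i j]
  = 1%E.

Definition conditional_law P
    (Q : env_off0 R d -> probability (prob_row R d) R) :=
  (forall A : set (prob_row R d), measurable A ->
     measurable_fun setT (fun v => Q v A)) /\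
  forall (A : set (prob_row R d)) (B : set (env_off0 R d)),
    measurable A -> measurable B ->
    P (row_at0 @^-1` A `&` rows_off0 @^-1` B)
    = (\int[distribution P rows_off0]_(v in B) Q v A)%E.

(* A Radon-Nikodym derivative is only determined up to null sets, for each [v]
   separately. To speak of it almost everywhere for a product measure one needs
   a version [f (w0, v)] which is jointly measurable; it exists, because the
   sigma-algebra of [prob_row] is countably generated. *)
Definition conditional_density P
    (Q : env_off0 R d -> probability (prob_row R d) R)
    (f : prob_row R d * env_off0 R d -> \bar R) :=
  measurable_fun setT f /\
  {ae distribution P rows_off0, forall v,
    ae_eq (distribution P row_at0) setT (fun w0 => f (w0, v))
      ('d (charge_of_finite_measure (Q v)) '/d (distribution P row_at0))}.

End EnvironmentMeasures.

Section Walk.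
Context {R : realType} {d : nat}.

(* Markov property and transition probabilities, with the conditional
   probabilities multiplied out. *)
Definition quenched_law (w : env R d) (x : lattice d)
    (mu : probability (trajectory d) R) :=
  mu [set X | X 0%N = x] = 1%E /\
  forall (n : nat) (s : nat -> lattice d) (j : lattice d),
    mu [set X | (forall k, (k <= n)%N -> X k = s k) /\ X n.+1 = j]
    = (mu [set X | forall k, (k <= n)%N -> X k = s k] * (jump w (s n) j)%:E)%E.

Definition annealed_expectation (P : probability (env R d) R)
    (P0 : env R d -> probability (trajectory d) R)
    (F : env R d -> trajectory d -> \bar R) : \bar R :=
  (\int[P]_w \int[P0 w]_X F w X)%E.

Definition exit_time (U : set (lattice d)) (X : trajectory d) : \bar R :=
  ereal_inf [set (j%:R)%:E | j in [set j : nat | ~ U (X j)]].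

Definition sum_to_exit (U : set (lattice d)) (X : trajectory d)
    (g : nat -> R) : \bar R :=
  (\sum_(0 <= j <oo | (j%:R%:E <= exit_time U X)%E) (g j)%:E)%E.

Definition kalikow_ratio (P : probability (env R d) R)
    (P0 : env R d -> probability (trajectory d) R)
    (l : 'rV[R]_d) (U : set (lattice d)) (x : lattice d) : \bar R :=
  (annealed_expectation P P0 (fun w X => sum_to_exit U X
     (fun j => ((X j == x)%:R * dot (drift (env_shift (X j) w)) l)%R))
   / annealed_expectation P P0 (fun w X => sum_to_exit U X
     (fun j => (X j == x)%:R)))%E.

Definition kalikow_condition (P : probability (env R d) R)
    (P0 : env R d -> probability (trajectory d) R) (M : R) (l : 'rV[R]_d) :=
  (0 < ereal_inf
    [set ereal_inf [set kalikow_ratio P P0 l U x | x in U] |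
      U in [set U : set (lattice d) |
             [/\ finite_set U, M_connected M U & U 0%R]]])%E.

End Walk.

(* Main.v *)
From HB Require Import structures.
Require Import Defs.
From mathcomp Require Import all_boot all_order all_algebra.
From mathcomp Require Import all_classical all_reals all_analysis.
From mathcomp Require Import measurable_realfun.
From mathcomp Require Import ring lra.

(**
Fix a finite trap [U] containing 0 and [x], and let [K] be the transition
matrix of the walk killed outside [U]. The expected number of visits to [x]
before the exit is the entry [G (0, x)] of [(1 - K)^-1], that is, a cofactor of
[1 - K] along row [x] divided by the determinant of [1 - K]. The cofactors along
row [x] do not depend on the environment at [x], and expanding the determinant
along this row gives a combination of terms, all of the same sign by the maximum
principle, weighted by the transition probabilities from [x], which lie between
[kappa] and 1. Replacing these weights by 1 yields a quantity
[g] which does not depend on the environment at [x] and satisfies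
[kappa G <= g <= G]. The drift at [x] depends only on the environment at [x], so
the density bounds give
[E (D^+ G) >= E (D^+ g) >= A E D^+ E g] and
[E (D^- G) <= kappa^-1 E (D^- g) <= kappa^-1 B E D^- E g], while
[E G <= kappa^-1 E g]. Hence every ratio in Kalikow's condition is at least
[kappa (A E D^+ - kappa^-1 B E D^-)].
*)

Set Implicit Arguments.
Unset Strict Implicit.
Unset Printing Implicit Defensive.

Import Order.TTheory GRing.Theory Num.Theory.
Import numFieldNormedType.Exports.

Local Open Scope classical_set_scope.
Local Open Scope charge_scope.
Local Open Scope ring_scope.

(* [vector.coord] shadows the coordinates of lattice points. *)
Local Notation coord := Defs.coord.

(** * Green functions of substochastic matrices *)

Section GreenMatrix.
Variables (R : realFieldType) (n : nat) (K : 'M[R]_n).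
Variable V : 'I_n -> R.
Hypothesis K_ge0 : forall i j, 0 <= K i j.
Hypothesis V_gt0 : forall i, 0 < V i.
Hypothesis KV : forall i, \sum_j K i j * V j < V i.

(** Compare [v] with the strict supersolution [V]. If the largest ratio [t = v m / V m] were
    positive, then [v <= t V] with equality at [m], so [(K v) m <= t (K V) m < t V m = v m], against
    the hypothesis at [m]. *)
Lemma max_principle (v : 'I_n -> R) :
  (forall i, 0 < v i -> v i <= \sum_j K i j * v j) -> forall i, v i <= 0.
Proof.
move=> vK i; rewrite leNgt; apply/negP => vi0.
pose m := [arg max_(j > i) (v j / V j)]%O.
have mP j : v j / V j <= v m / V m.
  by rewrite /m; case: arg_maxP => // k _ kP; exact: kP.
have t0 : 0 < v m / V m by apply: lt_le_trans (mP i); rewrite divr_gt0.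
have vm0 : 0 < v m by rewrite -(pmulr_lgt0 _ (_ : 0 < (V m)^-1)) ?invr_gt0.
have vV j : v j <= v m / V m * V j by rewrite -ler_pdivrMr.
have := vK m vm0; apply/negP; rewrite -ltNge.
apply: (@le_lt_trans _ _ (\sum_j K m j * (v m / V m * V j))).
  by apply: ler_sum => j _; exact: ler_wpM2l.
under eq_bigr do rewrite mulrCA.
by rewrite -mulr_sumr -[ltRHS](divfK (lt0r_neq0 (V_gt0 m))) ltr_pM2l.
Qed.

Lemma green_unit : 1%:M - K \in unitmx.
Proof.
(* [det0P] yields a row vector in the left kernel, hence the transpose. Such a [v] satisfies
   [v = K v], and the maximum principle for [v] and [- v] forces it to vanish. *)
rewrite unitmxE unitfE -det_tr; apply/negP => /det0P[v v0 vK].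
have vE i : v 0 i = \sum_j K i j * v 0 j.
  have := congr1 (fun A : 'rV_n => A 0 i) vK.
  rewrite linearB/= trmx1 mulmxBr mulmx1 !mxE => /eqP; rewrite subr_eq0 => /eqP->.
  by apply: eq_bigr => j _; rewrite mxE mulrC.
case/eqP: v0; apply/rowP => i; rewrite mxE; apply/eqP; rewrite eq_le.
rewrite (@max_principle (v 0))/=; last by move=> j _; rewrite -vE.
rewrite -oppr_le0; apply: (@max_principle (fun j => - v 0 j)) => j _.
by rewrite [in leLHS]vE -sumrN; apply: ler_sum => k _; rewrite mulrN.
Qed.

Let G := invmx (1%:M - K).

(** First-step decomposition, read off from [(1 - K) G = 1]. *)
Lemma greenE i k : G i k = (i == k)%:R + \sum_j K i j * G j k.
Proof.
have := congr1 (fun A : 'M[R]_n => A i k) (mulmxV green_unit).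
by rewrite mulmxBl mul1mx !mxE => <-; rewrite subrK.
Qed.

Lemma green_ge0 i k : 0 <= G i k.
Proof.
rewrite -oppr_le0; apply: (@max_principle (fun j => - G j k)) => j _.
rewrite greenE; under [leRHS]eq_bigr do rewrite mulrN.
by rewrite sumrN lerN2 lerDr ler0n.
Qed.

Lemma green_diag_ge1 k : 1 <= G k k.
Proof.
by rewrite greenE eqxx lerDl sumr_ge0// => j _; rewrite mulr_ge0// green_ge0.
Qed.

Hypothesis K_le1 : forall i, \sum_j K i j <= 1.

(** A walk from [i] must reach [k] before it counts any visit. Analytically, [G j k - G k k]
    vanishes at [j = k] and is subharmonic elsewhere, since row sums at most 1 only shrink the
    subtracted constant. *)
Lemma green_le_diag i k : G i k <= G k k.
Proof.
rewrite -subr_le0; apply: (@max_principle (fun j => G j k - G k k)) => j.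
have [->|jk _] := eqVneq j k; first by rewrite subrr ltxx.
under [leRHS]eq_bigr do rewrite mulrBr.
rewrite sumrB -mulr_suml {1}greenE (negbTE jk) add0r lerB//.
by rewrite ler_piMl// green_ge0.
Qed.

Lemma green_gt0_step i j k : 0 < K i j -> 0 < G j k -> 0 < G i k.
Proof.
move=> Kij Gjk; rewrite greenE ltr_wpDl ?ler0n// (bigD1 j)//=.
rewrite ltr_wpDr ?mulr_gt0// sumr_ge0// => m _.
by rewrite mulr_ge0// green_ge0.
Qed.

Lemma green_cofactor i k : G i k = cofactor (1%:M - K) k i / \det (1%:M - K).
Proof. by rewrite /G /invmx green_unit !mxE mulrC. Qed.

(* The denominator is [\det (1 - K)] expanded along row [x], except that the
   entries of [K] in that row and its defect [1 - \sum_j K x j] are replaced by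
   0 or 1; hence the quotient does not involve the row [x] of [K]. *)
Definition flat_green (x i : 'I_n) (b : bool) (nbr : pred 'I_n)
    (A : 'M[R]_n) : R :=
  let c j := cofactor (1%:M - A) x j in
  c i / (b%:R * c x + \sum_(j | nbr j) (c x - c j)).

(** The determinant cancels, leaving [G i x / s]. With the true weights of row [x] in place of the
    0-1 weights, [s] would be exactly 1. All terms are nonnegative by [green_le_diag], so comparing
    weights gives [1 <= s] and [kappa * s <= 1]. *)
Lemma flat_green_bounds (x i : 'I_n) (b : bool) (nbr : pred 'I_n) (kappa : R) :
  0 < kappa ->
  (forall j, kappa * (nbr j)%:R <= K x j <= (nbr j)%:R) ->
  kappa * b%:R <= 1 - \sum_j K x j <= b%:R ->
  kappa * G i x <= flat_green x i b nbr K <= G i x.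
Proof.
move=> k0 Kx Kb; set D := \det (1%:M - K).
have D0 : D != 0 by rewrite -unitfE -unitmxE green_unit.
pose s := b%:R * G x x + \sum_(j | nbr j) (G x x - G j x).
have gE : flat_green x i b nbr K = G i x / s.
  rewrite /flat_green.
  have cE j : cofactor (1%:M - K) x j = G j x * D.
    by rewrite green_cofactor -/D divfK.
  rewrite !cE; under [\sum_(j | nbr j) _]eq_bigr do rewrite cE -mulrBl.
  rewrite mulrA -mulr_suml -mulrDl -/s invfM.
  by rewrite mulrACA divff// mulr1.
(* The expansion of the determinant along row [x], divided by the determinant; equivalently, the
   first-step decomposition of [G x x]. *)
have one : 1 = (1 - \sum_j K x j) * G x x + \sum_j K x j * (G x x - G j x).
  have -> : \sum_j K x j * (G x x - G j x)
      = (\sum_j K x j) * G x x - \sum_j K x j * G j x.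
    by under eq_bigr do rewrite mulrBr; rewrite sumrB -mulr_suml.
  have := greenE x x; rewrite eqxx => e.
  by rewrite mulrBl mul1r addrA subrK {1}e addrK.
have sE : s = b%:R * G x x + \sum_j (nbr j)%:R * (G x x - G j x).
  rewrite /s big_mkcond; congr (_ + _); apply: eq_bigr => j _.
  by case: (nbr j); rewrite ?mul1r ?mul0r.
have s1 : 1 <= s.
  rewrite {1}one sE lerD//.
    by rewrite ler_wpM2r ?green_ge0//; case/andP: Kb.
  apply: ler_sum => j _; rewrite ler_wpM2r ?subr_ge0 ?green_le_diag//.
  by case/andP: (Kx j).
have sk : kappa * s <= 1.
  rewrite {1}one sE mulrDr lerD//.
    by rewrite mulrA ler_wpM2r ?green_ge0//; case/andP: Kb.
  rewrite mulr_sumr.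
  apply: ler_sum => j _; rewrite mulrA ler_wpM2r ?subr_ge0 ?green_le_diag//.
  by case/andP: (Kx j).
have s0 : 0 < s by exact: lt_le_trans s1.
rewrite gE ler_pdivlMr// ler_pdivrMr// ler_peMr ?green_ge0// andbT.
by rewrite mulrAC ler_piMl ?green_ge0.
Qed.

(** The cofactors along row [x] are minors from which that row has been deleted. *)
Lemma flat_green_row (x i : 'I_n) (b : bool) (nbr : pred 'I_n) (A B : 'M[R]_n) :
  (forall j k, j != x -> A j k = B j k) ->
  flat_green x i b nbr A = flat_green x i b nbr B.
Proof.
move=> AB.
have cE j : cofactor (1%:M - A) x j = cofactor (1%:M - B) x j.
  congr (_ * \det _); apply/matrixP => k m; rewrite !mxE AB//.
  by rewrite eq_sym neq_lift.
rewrite /flat_green !cE; congr (_ / (_ + _)).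
by apply: eq_bigr => j _; rewrite !cE.
Qed.

Variable i0 : 'I_n.

(** Row [i0] of the [N]-th power of [K]: for a killed walk started at [i0], the subprobability law
    of its position at time [N]. *)
Fixpoint occupation (N : nat) : 'rV[R]_n :=
  if N is N.+1 then occupation N *m K else delta_mx 0 i0.

Lemma occupation_ge0 N j : 0 <= occupation N 0 j.
Proof.
elim: N j => [|N IH] j /=; first by rewrite mxE ler0n.
by rewrite mxE sumr_ge0// => k _; rewrite mulr_ge0.
Qed.

(** Telescoping sum, kept applied to a vector [v]: taking [V] gives a bound uniform in [N], taking a
    column of [G] gives the exact value. *)
Lemma sum_occupation_mul N (v : 'cV[R]_n) :
  (\sum_(m < N) occupation m) *m ((1%:M - K) *m v)
  = row i0 v - occupation N *m v.
Proof.
rewrite rowE -mulmxBl mulmxA; congr (_ *m v); elim: N => [|N IH].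
  by rewrite big_ord0 mul0mx subrr.
by rewrite big_ord_recr mulmxDl IH mulmxBr mulmx1 /= addrA subrK.
Qed.

(** In the telescoped identity for [V] every summand is nonnegative because [K V < V], so the one at
    [j] is at most the total, itself at most [V i0]. *)
Lemma sum_occupation_le N j :
  (\sum_(m < N) occupation m 0 j) * (V j - \sum_k K j k * V k) <= V i0.
Proof.
have := sum_occupation_mul N (\col_k V k).
move=> /(congr1 (fun A : 'M[R]_1 => A 0 0)) e.
have : \sum_k (\sum_(m < N) occupation m 0 k) * (V k - \sum_m K k m * V m) <= V i0.
  have -> : \sum_k (\sum_(m < N) occupation m 0 k) * (V k - \sum_m K k m * V m)
      = V i0 - (occupation N *m \col_k V k) 0 0.
    move: e; rewrite !mxE => <-; apply: eq_bigr => k _.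
    rewrite summxE; congr (_ * _).
    rewrite mulmxBl mul1mx !mxE; congr (_ - _).
    by apply: eq_bigr => m _; rewrite mxE.
  rewrite gerBl mxE sumr_ge0// => k _.
  by rewrite mulr_ge0 ?occupation_ge0// mxE ltW.
apply: le_trans; rewrite [leRHS](bigD1 j)//= lerDl sumr_ge0// => k _.
rewrite mulr_ge0 ?subr_ge0 ?(ltW (KV k))// sumr_ge0// => m _.
exact: occupation_ge0.
Qed.

Lemma col_mul_green x : (1%:M - K) *m col x G = delta_mx x 0.
Proof. by rewrite colE mulmxA mulmxV ?green_unit// mul1mx. Qed.

Lemma sum_occupationE N x :
  \sum_(m < N) occupation m 0 x = G i0 x - \sum_j occupation N 0 j * G j x.
Proof.
have := sum_occupation_mul N (col x G).
rewrite col_mul_green => /(congr1 (fun A : 'M[R]_1 => A 0 0)).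
rewrite !mxE => e; transitivity (\sum_j (\sum_(m < N) occupation m) 0 j * (j == x)%:R).
  rewrite (bigD1 x)//= eqxx mulr1 summxE [X in _ + X]big1 ?addr0// => j /negbTE->.
  by rewrite mulr0.
have -> : \sum_j (\sum_(m < N) occupation m) 0 j * (j == x)%:R
   = \sum_j (\sum_(m < N) occupation m) 0 j * (delta_mx x 0 : 'cV[R]_n) j 0.
  by apply: eq_bigr => j _; rewrite !mxE eqxx andbT.
by rewrite e; congr (_ - _); apply: eq_bigr => j _; rewrite mxE.
Qed.

End GreenMatrix.

Section GreenBound.
Variables (R : realFieldType) (n : nat) (K : 'M[R]_n).
Variable V : 'I_n -> R.
Hypothesis K_ge0 : forall i j, 0 <= K i j.
Hypothesis V_gt0 : forall i, 0 < V i.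
Hypothesis KV : forall i, \sum_j K i j * V j < V i.
Let G := invmx (1%:M - K).

(** Maximum principle for the difference of the two sides as a function of [i]: it is harmonic at
    [k] by the choice of [W], and subharmonic elsewhere because [K V < V]. *)
Lemma green_mul_le i k : G i k * (V k - \sum_j K k j * V j) <= V i.
Proof.
rewrite -subr_le0; set W := V k - _.
apply: (max_principle K_ge0 V_gt0 KV (v := fun i => G i k * W - V i)) => j _.
rewrite (greenE K_ge0 V_gt0 KV) mulrDl -addrA [leRHS](_ : _ =
  (\sum_m K j m * G m k) * W - \sum_m K j m * V m); last first.
  rewrite mulr_suml -sumrB; apply: eq_bigr => m _; rewrite -/G; ring.
have [->|jk] := eqVneq j k; first by rewrite mul1r /W; lra.
by rewrite mul0r add0r lerB// ltW.
Qed.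

End GreenBound.

Section GreenSeries.
Variables (R : realType) (n : nat) (K : 'M[R]_n).
Variable V : 'I_n -> R.
Hypothesis K_ge0 : forall i j, 0 <= K i j.
Hypothesis V_gt0 : forall i, 0 < V i.
Hypothesis KV : forall i, \sum_j K i j * V j < V i.
Variable i0 : 'I_n.

Lemma cvg_series_occupation j :
  cvgn (series (fun m => occupation K i0 m 0 j : R)).
Proof.
apply: nondecreasing_is_cvgn.
  apply/nondecreasing_seqP => N; rewrite !seriesEord/= big_ord_recr/= lerDl.
  exact: occupation_ge0.
exists (V i0 / (V j - \sum_k K j k * V k)) => _ [N _ <-].
by rewrite seriesEord/= ler_pdivlMr ?subr_gt0// sum_occupation_le.
Qed.

(** By [sum_occupationE] the partial sums miss the entry of the inverse by a linear combination of
    the [occupation K i0 N 0 j], which tend to 0 as terms of convergent series. *)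
Lemma green_series x :
  (\sum_(0 <= m <oo) (occupation K i0 m 0 x)%:E
   = (invmx (1%:M - K) i0 x)%:E)%E.
Proof.
apply: cvg_lim => //.
have -> : (fun N => \sum_(0 <= m < N) (occupation K i0 m 0 x)%:E)%E =
    EFin \o (fun N => invmx (1%:M - K) i0 x -
      \sum_j occupation K i0 N 0 j * invmx (1%:M - K) j x).
  apply/funext => N /=; rewrite sumEFin big_mkord.
  by rewrite (sum_occupationE K_ge0 V_gt0 KV).
apply: cvg_EFin; first exact: nearW.
rewrite -[X in _ --> X]subr0; apply: cvgB; first exact: cvg_cst.
rewrite [X in _ --> X](_ : 0 = \sum_(j < n) 0 :> R); last by rewrite big1.
apply: cvg_big => [|j _]; first exact: add_continuous.
rewrite -[X in _ --> X](mul0r (invmx (1%:M - K) j x)).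
by apply: cvgM; [apply: cvg_series_cvg_0; exact: cvg_series_occupation|exact: cvg_cst].
Qed.

End GreenSeries.

(** * Finite traps in elliptic environments *)

Section ProbVectorSums.
Context {R : realType} {d : nat}.
Implicit Type p : prob_vector R d.

Lemma weight_ge0 p z : 0 <= p z.
Proof. by case/andP: (weight_itv p z). Qed.

Lemma weight_le1 p z : p z <= 1.
Proof. by case/andP: (weight_itv p z). Qed.

Lemma sum_weight_le1 p (s : seq (lattice d)) : uniq s -> \sum_(z <- s) p z <= 1.
Proof.
move=> us; rewrite -lee_fin -sumEFin -(weight_sum1 p); apply: esum_ge.
by exists [set` s]; [split => //; exact: finite_seq|rewrite -fsbig_seq].
Qed.

Lemma sum_weight1 p (s : seq (lattice d)) : uniq s ->
  (forall z, z \notin s -> p z = 0) -> \sum_(z <- s) p z = 1.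
Proof.
move=> us p0; apply/eqP; rewrite -eqe -sumEFin -(weight_sum1 p).
rewrite (esumID [set` s])//; last by move=> z _; rewrite lee_fin weight_ge0.
rewrite !setTI esum_fset//; last 2 first.
- exact: finite_seq.
- by move=> z _; rewrite lee_fin weight_ge0.
rewrite fsbig_seq// [X in (_ + X)%E]esum1 ?adde0// => z /= /negP zs.
by rewrite p0.
Qed.

End ProbVectorSums.

Section LatticeNorm.
Context {R : realType} {d : nat}.
Implicit Types x y : lattice d.

Lemma coordD x (z : lattice d) k : coord (x + z : lattice d) k = coord x k + coord z k.
Proof. by rewrite /coord -[x + z]/((x : 'rV[int]_d) + z) mxE. Qed.

Lemma coordN x k : coord (- x : lattice d) k = - coord x k.
Proof. by rewrite /coord -[- x]/(- (x : 'rV[int]_d)) mxE. Qed.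

Lemma coord_delta (k : 'I_d) : coord (delta_mx 0 k : lattice d) k = 1.
Proof. by rewrite /coord mxE !eqxx. Qed.

Lemma lattice_normN x : lattice_norm (- x) = lattice_norm x :> R.
Proof.
congr Num.sqrt; apply: eq_bigr => k _.
by rewrite coordN rmorphN sqrrN.
Qed.

Lemma lattice_norm_delta (k : 'I_d) : lattice_norm (delta_mx 0 k : lattice d) = 1 :> R.
Proof.
rewrite /lattice_norm (bigD1 k)//= big1 ?addr0.
  by rewrite /coord mxE !eqxx/= expr1n sqrtr1.
by move=> j jk; rewrite /coord mxE (negbTE jk) andbF expr0n.
Qed.

Lemma le_coord_norm x k : `|(coord x k)%:~R| <= lattice_norm x :> R.
Proof.
rewrite -sqrtr_sqr ler_sqrt; last by apply: sumr_ge0 => j _; exact: sqr_ge0.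
by rewrite (bigD1 k)//= lerDl sumr_ge0// => j _; exact: sqr_ge0.
Qed.

End LatticeNorm.

Section GoodEnvironment.
Context {R : realType} {d : nat}.
Variables (M kappa : R).

(** Finite range and ellipticity as a property of one environment, so that the matrix estimates can
    be made pointwise before integrating. *)
Definition good_env (w : env R d) :=
  (forall i j, M < lattice_norm (i - j) -> jump w i j = 0) /\
  (forall i j, lattice_norm (i - j) <= M -> kappa < jump w i j).

(** Transition matrix of the walk killed on leaving [range y]; the enumeration [y] turns lattice
    points into matrix indices. *)
Definition trap_mx n (y : 'I_n -> lattice d) (w : env R d) : 'M[R]_n :=
  \matrix_(i, j) jump w (y i) (y j).

Variables (n : nat) (y : 'I_n -> lattice d).
Hypothesis y_inj : injective y.

Lemma trap_mx_ge0 w i j : 0 <= trap_mx y w i j.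
Proof. by rewrite mxE weight_ge0. Qed.

Lemma uniq_codom : uniq (codom y).
Proof. by rewrite map_inj_uniq ?enum_uniq. Qed.

Lemma sum_trap_mxE w i : \sum_j trap_mx y w i j = \sum_(z <- codom y) w (y i) z.
Proof. by rewrite big_map enumT; apply: eq_bigr => j _; rewrite mxE. Qed.

Lemma sum_trap_mx_le1 w i : \sum_j trap_mx y w i j <= 1.
Proof. by rewrite sum_trap_mxE sum_weight_le1 ?uniq_codom. Qed.

Lemma sum_trap_mx_out w i z : z \notin codom y ->
  jump w (y i) z <= 1 - \sum_j trap_mx y w i j.
Proof.
move=> zy; rewrite lerBrDr sum_trap_mxE.
have := @sum_weight_le1 _ _ (w (y i)) (z :: codom y).
by rewrite big_cons /= zy uniq_codom; exact.
Qed.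

Hypotheses (M_ge1 : 1 <= M) (kappa_itv : 0 < kappa < 1).
Variable k0 : 'I_d.

(* A step in direction [k0] multiplies [a ^ h] by [a] and has probability at
   least [kappa], hence [a ^ h] at least doubles on average. *)
Let a := 2 / kappa.
Let h i := coord (y i) k0.
Let L := a * \sum_i a ^ h i.

Definition lyapunov (i : 'I_n) : R := L - a ^ h i.

Let k_gt0 : 0 < kappa. Proof. by case/andP: kappa_itv. Qed.
Let a_gt1 : 1 < a.
Proof. by rewrite /a ltr_pdivlMr// mul1r; case/andP: kappa_itv => _; lra. Qed.
Let a_gt0 : 0 < a. Proof. exact: lt_trans a_gt1. Qed.
Let ah_gt0 i : 0 < a ^ h i. Proof. exact: exprz_gt0. Qed.
Let L_ge i : a * a ^ h i <= L.
Proof.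
rewrite /L ler_pM2l// (bigD1 i)//= lerDl sumr_ge0// => j _.
exact/ltW/ah_gt0.
Qed.

Lemma lyapunov_gt0 i : 0 < lyapunov i.
Proof.
by rewrite subr_gt0 (lt_le_trans _ (L_ge i))// ltr_pMl.
Qed.

(** The left-over is [L (1 - \sum_j K i j) + \sum_j K i j * a ^ h j - a ^ h i]. If the step along
    [k0] stays in the trap, the second term is at least [kappa * a * a ^ h i = 2 * a ^ h i].
    Otherwise mass at least [kappa] is killed, and [L >= a * a ^ h i] makes the first term that
    large. *)
Lemma trap_mx_lyapunov w i : good_env w ->
  a ^ h i <= lyapunov i - \sum_j trap_mx y w i j * lyapunov j.
Proof.
move=> [_ ell].
have L0 : 0 <= L by rewrite (le_trans _ (L_ge i))// mulr_ge0// ltW.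
pose z : lattice d := y i + delta_mx 0 k0.
have pz : kappa <= jump w (y i) z.
  by rewrite ltW// ell// /z opprD addrA subrr add0r lattice_normN lattice_norm_delta.
have e : \sum_j trap_mx y w i j * lyapunov j =
    L * \sum_j trap_mx y w i j - \sum_j trap_mx y w i j * a ^ h j.
  rewrite mulr_sumr -sumrB; apply: eq_bigr => j _.
  by rewrite /lyapunov; ring.
have S0 : 0 <= \sum_j trap_mx y w i j * a ^ h j.
  by apply: sumr_ge0 => j _; rewrite mulr_ge0 ?trap_mx_ge0// ltW.
have kL : 2 * a ^ h i <= kappa * L.
  rewrite (le_trans _ (ler_wpM2l (ltW k_gt0) (L_ge i)))// mulrA /a.
  by rewrite [kappa * _]mulrC divfK ?gt_eqF.
rewrite e /lyapunov; have [/codomP[j zj]|zy] := boolP (z \in codom y).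
  have hj : h j = h i + 1.
    by rewrite /h -zj coordD coord_delta.
  have : 2 * a ^ h i <= \sum_j trap_mx y w i j * a ^ h j.
    rewrite (bigD1 j)//= hj expfzDr ?gt_eqF// expr1z.
    rewrite (le_trans (_ : _ <= kappa * (a ^ h i * a)))//.
      by rewrite mulrCA /a [kappa * _]mulrC divfK ?gt_eqF// mulrC.
    rewrite ler_wpDr ?sumr_ge0//.
      by move=> m _; rewrite mulr_ge0 ?trap_mx_ge0// ltW.
    apply: ler_wpM2r; first by rewrite mulr_ge0// ltW.
    by rewrite mxE -zj.
  have := sum_trap_mx_le1 w i; nra.
have := sum_trap_mx_out w i zy; nra.
Qed.

Section GoodBounds.
Variable w : env R d.
Hypothesis good_w : good_env w.

Let KV i : \sum_j trap_mx y w i j * lyapunov j < lyapunov i.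
Proof.
by rewrite -subr_gt0 (lt_le_trans (ah_gt0 i))// trap_mx_lyapunov.
Qed.

Let K0 := trap_mx_ge0 w.

(** In a good environment, [neighbour] and [on_boundary] tell where row [x] of the killed matrix and
    its defect are nonzero. They depend on the geometry alone, so they can replace the random
    weights of that row. *)
Definition neighbour (x : 'I_n) : pred 'I_n :=
  fun j => lattice_norm (y x - y j) <= M.

Definition on_boundary (x : 'I_n) : bool :=
  `[< exists2 z, z \notin codom y & lattice_norm (y x - z) <= M >].

Lemma trap_green_series i x :
  (\sum_(0 <= m <oo) (occupation (trap_mx y w) i m 0 x)%:E
   = (invmx (1%:M - trap_mx y w) i x)%:E)%E.
Proof. exact: green_series K0 lyapunov_gt0 KV i x. Qed.

Lemma trap_green_bounds i x :
  let g := invmx (1%:M - trap_mx y w) i x in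
  kappa * g <= flat_green x i (on_boundary x) (neighbour x) (trap_mx y w) <= g.
Proof.
apply: (flat_green_bounds K0 lyapunov_gt0 KV (sum_trap_mx_le1 w)) => //.
  move=> j; rewrite /neighbour mxE; case: (leP (lattice_norm (y x - y j)) M) => xj.
    by rewrite /= mulr1n mulr1 weight_le1 andbT ltW// (proj2 good_w).
  by rewrite /= mulr0n mulr0 (proj1 good_w)// lexx.
rewrite /on_boundary; case: asboolP => [[z zy xz]|out].
  rewrite /= mulr1n mulr1 gerBl sumr_ge0 ?andbT//.
  by rewrite (le_trans _ (sum_trap_mx_out w x zy))// ltW// (proj2 good_w).
(* Away from the boundary, finite range keeps every jump from [x] inside the trap, so the defect is
   exactly 0. *)
rewrite /= mulr0n mulr0 sum_trap_mxE sum_weight1 ?uniq_codom ?subrr ?lexx// => z zy.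
apply: (proj1 good_w); rewrite ltNge; apply/negP => xz; apply: out.
by exists z.
Qed.

(** The right-hand side does not depend on the environment, which makes the expectation of the
    flattened Green function finite. *)
Lemma trap_green_le i x :
  invmx (1%:M - trap_mx y w) i x <= lyapunov i / a ^ h x.
Proof.
rewrite ler_pdivlMr//.
apply: le_trans (green_mul_le K0 lyapunov_gt0 KV i x).
by rewrite ler_wpM2l ?(green_ge0 K0 lyapunov_gt0 KV)// trap_mx_lyapunov.
Qed.

(** Positivity at a point passes to every point of the trap that can jump to it. By ellipticity and
    the symmetry of the norm, it spreads both ways along the connecting path, starting from [x]. *)
Lemma trap_green_gt0 i x : M_connected M (range y) ->
  0 < invmx (1%:M - trap_mx y w) i x.
Proof.
move=> [s [sy sM]].
pose pos z := exists2 j, y j = z & 0 < invmx (1%:M - trap_mx y w) j x.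
have posM z z' : z' \in codom y -> lattice_norm (z' - z) <= M -> pos z -> pos z'.
  move=> /codomP[j ->] zM [k ykz Gk]; exists j => //.
  apply: (green_gt0_step K0 lyapunov_gt0 KV _ Gk).
  by rewrite mxE (lt_trans k_gt0)// (proj2 good_w)// ykz.
have inU z : z \in s -> z \in codom y.
  move=> zs; have : [set` s] z by [].
  by rewrite sy => -[j _ <-]; exact: codom_f.
have sE z : z \in codom y -> z \in s.
  move=> /codomP[j ->].
  have : range y (y j) by exists j.
  by rewrite -sy.
have posx : pos (y x).
  exists x => //; apply: lt_le_trans ltr01 _.
  exact: (green_diag_ge1 K0 lyapunov_gt0 KV).
suff : forall z, z \in s -> pos z.
  by move/(_ _ (sE _ (codom_f y i))) => -[j /y_inj ->].
have {posx} : exists2 z, z \in s & pos z by exists (y x); rewrite ?sE ?codom_f.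
case: s sM inU {sy sE} => [_ _ [//]|z0 s /= sM inU].
(* The head of the path serves as a relay: positivity moves from any point back to the head, then
   from the head to all points. *)
have head_all : forall (t : seq (lattice d)) (z1 : lattice d),
    path (fun x y => lattice_norm (y - x) <= M) z1 t ->
    {subset z1 :: t <= codom y} ->
    (forall z, z \in z1 :: t -> pos z -> pos z1) /\
    (pos z1 -> forall z, z \in z1 :: t -> pos z).
  elim=> [|z2 t IH] z1 /=.
    by move=> _ _; split => [z|? z]; rewrite inE => /eqP->.
  move=> /andP[z12 tM] tU; have tU' : {subset z2 :: t <= codom y}.
    by move=> z zt; apply: tU; rewrite inE zt orbT.
  have [IH1 IH2] := IH z2 tM tU'.
  have z1U : z1 \in codom y by apply: tU; rewrite mem_head.
  have z2U : z2 \in codom y by apply: tU; rewrite inE mem_head orbT.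
  split=> [z|p1 z]; rewrite inE => /predU1P[->//|zt].
    move=> /(IH1 z zt); apply: posM => //.
    by rewrite -(lattice_normN (z1 - z2)) opprB.
  by apply: IH2 => //; exact: posM p1.
have [h1 h2] := head_all s z0 sM inU.
by move=> [z zs pz]; apply: h2; exact: h1 pz.
Qed.

End GoodBounds.

End GoodEnvironment.

(** * The drift as a bounded function of a single row *)

Section RowDrift.
Context {R : realType} {d : nat}.

Definition row_drift (p : prob_row R d) : 'rV[R]_d :=
  \row_k lattice_sum (fun i : lattice d => (coord i k)%:~R * weight p i).

(** Both the positive and the negative part are dominated by [M * p], whose finite sums are at most
    [M]; so both suprema are finite and [fine] loses nothing. *)
Lemma le_lattice_sum (p : prob_vector R d) (M : R) (f : lattice d -> R) : 0 <= M ->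
  (forall i, `|f i| <= M * p i) -> `|lattice_sum f| <= M + M.
Proof.
move=> M0 fM.
have bd (g : lattice d -> R) : (forall i, 0 <= g i <= M * p i) ->
    0 <= fine (\esum_(i in [set: lattice d]) (g i)%:E) <= M.
  move=> gM.
  have e0 : (0 <= \esum_(i in [set: lattice d]) (g i)%:E)%E.
    by apply: esum_ge0 => i _; rewrite lee_fin; case/andP: (gM i).
  have eM : (\esum_(i in [set: lattice d]) (g i)%:E <= M%:E)%E.
    apply: ge_ereal_sup => _ [X [Xfin _] <-].
    rewrite fsbig_finite//= sumEFin lee_fin.
    apply: (le_trans (_ : _ <= M * \sum_(i <- finmap.enum_fset (fset_set X)) p i)).
      by rewrite mulr_sumr; apply: ler_sum => i _; case/andP: (gM i).
    by apply: ler_piMr => //; apply: sum_weight_le1; exact: finmap.fset_uniq.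
  rewrite fine_ge0//= -lee_fin fineK// ge0_fin_numE//.
  exact: le_lt_trans eM (ltry _).
have /bd/andP[p1 p2] : forall i, 0 <= f^\+ i <= M * p i.
  move=> i; rewrite funrpos_ge0/= (le_trans _ (fM i))//.
  by rewrite /funrpos ge_max normr_ge0 ler_norm.
have /bd/andP[n1 n2] : forall i, 0 <= f^\- i <= M * p i.
  move=> i; rewrite funrneg_ge0/= (le_trans _ (fM i))//.
  by rewrite /funrneg ge_max normr_ge0 -normrN ler_norm.
rewrite /lattice_sum (le_trans (ler_normB _ _))// lerD//.
  by rewrite ger0_norm.
by rewrite ger0_norm.
Qed.

Lemma dot_row_drift_le (M : R) (l : 'rV[R]_d) (w : env R d) (kappa : R) :
  1 <= M -> good_env M kappa w ->
  `|dot (row_drift (row_at0 w)) l| <= \sum_k (M + M) * `|l ord0 k|.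
Proof.
move=> M1 [fr _]; have M0 : 0 <= M by lra.
rewrite (le_trans (ler_norm_sum _ _ _))//; apply: ler_sum => k _.
rewrite normrM ler_wpM2r// mxE (@le_lattice_sum (w 0))// => i.
rewrite normrM (ger0_norm (weight_ge0 _ _)).
have [iM|Mi] := leP (lattice_norm i) M.
  by rewrite ler_wpM2r ?weight_ge0// (le_trans (le_coord_norm _ _)).
by rewrite [weight _ _](fr 0 i) ?mulr0// sub0r lattice_normN.
Qed.

End RowDrift.

(** * Measurability *)

Section MeasurableMatrix.
Context d (T : measurableType d) (R : realType).

Lemma measurable_fun_det n (A : T -> 'M[R]_n) :
  (forall i j, measurable_fun setT (fun t => A t i j)) ->
  measurable_fun setT (fun t => \det (A t)).
Proof.
move=> mA; apply: measurable_sum => s; apply: measurable_funM => //.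
by apply: measurable_prod => i _; exact: mA.
Qed.

Lemma measurable_fun_cofactor n (A : T -> 'M[R]_n) i j :
  (forall i j, measurable_fun setT (fun t => A t i j)) ->
  measurable_fun setT (fun t => cofactor (A t) i j).
Proof.
move=> mA; apply: measurable_funM => //; apply: measurable_fun_det => k l.
by under eq_fun do rewrite !mxE; exact: mA.
Qed.

Lemma measurable_funV (f : T -> R) :
  measurable_fun setT f -> measurable_fun setT (fun t => (f t)^-1).
Proof.
(* Passing through the square keeps the base of the real power nonnegative; where [f] vanishes both
   sides are 0. *)
move=> mf; have -> : (fun t => (f t)^-1) = (fun t => f t * (f t ^+ 2) `^ (-1)).
  apply/funext => t; rewrite powR_inv1 ?sqr_ge0//.
  have [->|ft] := eqVneq (f t) 0; first by rewrite invr0 mul0r.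
  by rewrite expr2 invfM mulrA divff// mul1r.
apply: measurable_funM => //.
by apply: (measurableT_comp (measurable_powR _)); exact: measurable_funX.
Qed.

Lemma measurable_flat_green n (A : T -> 'M[R]_n) x i b nbr :
  (forall i j, measurable_fun setT (fun t => A t i j)) ->
  measurable_fun setT (fun t => flat_green x i b nbr (A t)).
Proof.
move=> mA.
have mc j : measurable_fun setT (fun t => cofactor (1%:M - A t) x j).
  apply: measurable_fun_cofactor => k l; under eq_fun do rewrite !mxE.
  exact: measurable_funB.
apply: measurable_funM => //; apply: measurable_funV.
apply: measurable_funD; first exact: measurable_funM.
under eq_fun do rewrite big_mkcond; apply: measurable_sum => j.
by case: (nbr j) => //; exact: measurable_funB.
Qed.

Lemma measurable_occupation n (A : T -> 'M[R]_n) i m j :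
  (forall i j, measurable_fun setT (fun t => A t i j)) ->
  measurable_fun setT (fun t => occupation (A t) i m 0 j).
Proof.
move=> mA; elim: m j => [|m IH] j /=; first exact: measurable_cst.
under eq_fun do rewrite mxE; apply: measurable_sum => k.
exact: measurable_funM.
Qed.

End MeasurableMatrix.

Section MeasurableLatticeSum.
Context d (T : measurableType d) (R : realType).

Lemma measurable_esum (I : countType) (a : I -> T -> R) :
  (forall i, measurable_fun setT (a i)) -> (forall i t, 0 <= a i t) ->
  measurable_fun setT (fun t => \esum_(i in [set: I]) (a i t)%:E)%E.
Proof.
(* The family is reindexed along [pickle] to become a series over [nat], with default value 0 where
   [unpickle] returns nothing. *)
move=> ma a0; pose b n t := (oapp (a^~ t) 0 (unpickle n))%:E.
have b0 n t : (0 <= b n t)%E by rewrite /b lee_fin; case: unpickle => /=.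
have -> : (fun t => \esum_(i in [set: I]) (a i t)%:E)%E =
    (fun t => \sum_(n <oo | n \in range (@pickle I)) b n t)%E.
  apply/funext => t; rewrite nneseries_esum//.
  rewrite (_ : [set x | _] = range (@pickle I)); last first.
    by apply/seteqP; split => n /=; rewrite inE.
  have bp : set_bij [set: I] (range (@pickle I)) pickle.
    by apply: inj_bij => i j _ _; exact: (pcan_inj pickleK).
  rewrite (@reindex_esum _ _ _ _ _ _ _ bp).
  by apply: eq_esum => i _; rewrite /b pickleK.
apply: ge0_emeasurable_sum => // n _; apply/measurable_EFinP.
by case: (unpickle n) => [i|] /=; [exact: ma|exact: measurable_cst].
Qed.

Lemma measurable_lattice_sum k (f : lattice k -> T -> R) :
  (forall i, measurable_fun setT (f i)) ->
  measurable_fun setT (fun t => lattice_sum (f^~ t)).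
Proof.
move=> mf; apply: measurable_funB; apply: measurableT_comp => //.
- apply: (@measurable_esum _ (fun i t => (f^~ t)^\+ i)) => [i|i t].
    exact: measurable_maxr.
  exact: funrpos_ge0.
- apply: (@measurable_esum _ (fun i t => (f^~ t)^\- i)) => [i|i t].
    by apply: measurable_maxr => //; exact: measurable_funN.
  exact: funrneg_ge0.
Qed.

End MeasurableLatticeSum.

Section MeasurableEnvironment.
Context {R : realType} {d : nat}.

Lemma measurable_weight j :
  measurable_fun setT (fun p : prob_row R d => weight p j).
Proof.
move=> _ C mC; apply: sub_sigma_algebra; exists j => //.
by exists C; rewrite // setTI.
Qed.

Lemma measurable_env_row i : measurable_fun setT (fun w : env R d => w i).
Proof.
move=> _ C mC; apply: sub_sigma_algebra; exists i => //.
by exists C; rewrite // setTI.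
Qed.

Lemma measurable_off0_row i : measurable_fun setT (fun v : env_off0 R d => v i).
Proof.
move=> _ C mC; apply: sub_sigma_algebra; exists i => //.
by exists C; rewrite // setTI.
Qed.

Lemma measurable_jump i j : measurable_fun setT (fun w : env R d => jump w i j).
Proof. exact: measurableT_comp (measurable_weight j) (measurable_env_row i). Qed.

Lemma measurable_to_prob_row k (T : measurableType k) (F : T -> prob_row R d) :
  (forall j, measurable_fun setT (fun t => weight (F t) j)) ->
  measurable_fun setT F.
Proof.
move=> mF; apply: measurability; first exact: erefl.
move=> _ [_ [j _ [C mC <-]] <-]; rewrite !setTI.
by have := mF j measurableT C mC; rewrite setTI.
Qed.

Lemma measurable_to_env k (T : measurableType k) (F : T -> env R d) :
  (forall i, measurable_fun setT (fun t => F t i)) -> measurable_fun setT F.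
Proof.
move=> mF; apply: measurability; first exact: erefl.
move=> _ [_ [i _ [C mC <-]] <-]; rewrite !setTI.
by have := mF i measurableT C mC; rewrite setTI.
Qed.

Lemma measurable_env_shift k : measurable_fun setT (@env_shift R d k).
Proof.
apply: measurable_to_env => i; apply: measurable_to_prob_row => j.
exact: measurable_jump.
Qed.

(** The origin receives an arbitrary row, so that matrix functions ignoring this row can be
    evaluated on [env_off0]. *)
Definition env_of_off0 (v : env_off0 R d) : env R d :=
  fun y => if insub y is Some y' then v y' else point.

Lemma measurable_env_of_off0 : measurable_fun setT env_of_off0.
Proof.
apply: measurable_to_env => i; rewrite /env_of_off0.
by case: insub => [y|]; [exact: measurable_off0_row|exact: measurable_cst].
Qed.

Lemma env_of_off0E (w : env R d) y : y != 0 -> env_of_off0 (rows_off0 w) y = w y.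
Proof. by move=> y0; rewrite /env_of_off0 insubT. Qed.

Lemma measurable_trap_mx n (y : 'I_n -> lattice d) i j :
  measurable_fun setT (fun w : env R d => trap_mx y w i j).
Proof.
have -> : (fun w : env R d => trap_mx y w i j) = (fun w => jump w (y i) (y j)).
  by apply/funext => w; rewrite mxE.
exact: measurable_jump.
Qed.

Lemma measurable_dot_row_drift (l : 'rV[R]_d) :
  measurable_fun setT (fun p : prob_row R d => dot (row_drift p) l).
Proof.
apply: measurable_sum => k; apply: measurable_funM => //.
have -> : (fun p : prob_row R d => row_drift p ord0 k) = (fun p =>
    lattice_sum (fun i : lattice d => (coord i k)%:~R * weight p i)).
  by apply/funext => p; rewrite mxE.
apply: (@measurable_lattice_sum _ (prob_row R d) R d
  (fun i p => (coord i k)%:~R * weight p i)).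
by move=> i; apply: measurable_funM => //; exact: measurable_weight.
Qed.

(** Recentering at [x] moves the row at [x] to the origin, where [row_at0] and [rows_off0] separate
    it from the others. *)
Lemma trap_mx_shift n (y : 'I_n -> lattice d) x (w : env R d) :
  trap_mx (fun i => y i - x) (env_shift x w) = trap_mx y w.
Proof.
by apply/matrixP => i j; rewrite !mxE /jump/= /jump !(addrC x) !subrK.
Qed.

Variables (M kappa : R).

Lemma measurable_forall_jump (C : lattice d -> lattice d -> set R) :
  (forall i j, measurable (C i j)) ->
  measurable [set w : env R d | forall i j, C i j (jump w i j)].
Proof.
move=> mC; rewrite (_ : [set w | _] = \bigcap_(ij in [set: lattice d * lattice d])
   ((fun w : env R d => jump w ij.1 ij.2) @^-1` C ij.1 ij.2)); last first.
  by apply/seteqP; split => w /= h => [[i j] _|i j]; [exact: h|exact: (h (i, j))].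
rewrite -[X in measurable X]setCK setC_bigcap; apply: measurableC.
apply: countable_bigcupT_measurable => // ij; apply: measurableC.
by rewrite -[X in measurable X]setTI; exact: measurable_jump.
Qed.

Lemma ae_of_probability1 (P : probability (env R d) R) (S : set (env R d)) :
  measurable S -> P S = 1%E -> {ae P, forall w, S w}.
Proof.
move=> mS PS; exists (~` S); split => //; first exact: measurableC.
by rewrite probability_setC// PS subee.
Qed.

Lemma ae_good_env (P : probability (env R d) R) :
  finite_range P M -> elliptic P M kappa ->
  {ae P, forall w, good_env M kappa w}.
Proof.
(* Each implication becomes membership of [jump w i j] in a fixed set, [setT] when the premise
   fails; both events are then countable intersections. *)
pose C1 (i j : lattice d) : set R :=
  if M < lattice_norm (i - j) then [set 0] else setT.
pose C2 (i j : lattice d) : set R :=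
  if lattice_norm (i - j) <= M then `]kappa, +oo[%classic else setT.
have mC1 : measurable [set w : env R d | forall i j, C1 i j (jump w i j)].
  by apply: measurable_forall_jump => i j; rewrite /C1; case: ifP.
have mC2 : measurable [set w : env R d | forall i j, C2 i j (jump w i j)].
  apply: measurable_forall_jump => i j; rewrite /C2.
  by case: ifP => // _; exact: measurable_itv.
have -> : finite_range P M =
    (P [set w | forall i j, C1 i j (jump w i j)] = 1%E).
  congr (P _ = _); apply/seteqP; split => w /= h i j; have := h i j; rewrite /C1.
    by case: ifP => // _ /(_ isT).
  by case: ifP.
have -> : elliptic P M kappa =
    (P [set w | forall i j, C2 i j (jump w i j)] = 1%E).
  congr (P _ = _); apply/seteqP; split => w /= h i j; have := h i j; rewrite /C2.
    by case: ifP => // _ /(_ isT); rewrite /= in_itv/= andbT.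
  by case: ifP => //; rewrite /= in_itv/= andbT.
move=> h1 h2.
apply: filterS2 (ae_of_probability1 mC1 h1) (ae_of_probability1 mC2 h2).
move=> w /= g1 g2; split=> i j ij.
  by have := g1 i j; rewrite /C1 ij.
by have := g2 i j; rewrite /C2 ij /= in_itv/= andbT.
Qed.

End MeasurableEnvironment.

(** * Visits before the exit time *)

(** The factor has no prescribed sign, as it will be a component of the drift; a negative [c] is
    treated through [- c]. *)
Lemma nneseriesZ (R : realType) (a : nat -> \bar R) (c : R) :
  (forall n, 0 <= a n)%E ->
  (\sum_(0 <= n <oo) (c%:E * a n) = c%:E * \sum_(0 <= n <oo) a n)%E.
Proof.
move=> a0; have [c0|c0] := leP 0 c; first by rewrite nneseriesZl.
have Nc0 : 0 <= - c by rewrite oppr_ge0 ltW.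
rewrite -[X in (X%:E * (limn _))%E](opprK c) EFinN mulNe -nneseriesZl//.
have NcE n : (c%:E * a n = - ((- c)%:E * a n))%E by rewrite EFinN mulNe oppeK.
rewrite -limeN; last first.
  by apply: is_cvg_nneseries => n _ _; rewrite mule_ge0.
congr (limn _); apply/funext => N /=.
rewrite -sumeN; first by apply: eq_bigr => n _.
move=> i j _ _; apply: ge0_adde_def; rewrite inE mule_ge0//.
Qed.

Section Trajectories.
Context {d : nat}.

Lemma measurable_position (k : nat) (S : set (lattice d)) :
  measurable [set X : trajectory d | S (X k)].
Proof.
apply: sub_sigma_algebra; exists k => //.
by exists S; rewrite // setTI.
Qed.

Context {R : realType}.
Variables (w : env R d) (mu : probability (trajectory d) R).
Hypothesis Hmu : quenched_law w 0 mu.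
Variables (n : nat) (y : 'I_n -> lattice d).
Hypothesis y_inj : injective y.

Definition trapped (N : nat) (j : 'I_n) : set (trajectory d) :=
  [set X | (forall k, (k <= N)%N -> range y (X k)) /\ X N = y j].

Lemma measurable_trapped N j : measurable (trapped N j).
Proof.
rewrite (_ : trapped N j = (\bigcap_(k in [set k | (k <= N)%N])
  [set X | range y (X k)]) `&` [set X | [set y j] (X N)])//.
apply: measurableI; last exact: measurable_position.
by apply: bigcap_measurableType => k _; exact: measurable_position.
Qed.

(** Interpolates between [trapped] and the fully prescribed paths to which the Markov property in
    [quenched_law] applies. *)
Let prefix (N : nat) (j : 'I_n) (m : nat) (s : nat -> lattice d) :
    set (trajectory d) :=
  [set X | forall k, (k < m)%N -> X k = s k] `&` trapped N j.

Let measurable_prefix N j m s : measurable (prefix N j m s).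
Proof.
apply: measurableI; last exact: measurable_trapped.
rewrite (_ : [set X | _] = \bigcap_(k in [set k | (k < m)%N])
  [set X : trajectory d | [set s k] (X k)])//.
by apply: bigcap_measurableType => k _; exact: measurable_position.
Qed.

Let upd (s : nat -> lattice d) m z := fun k => if k == m then z else s k.

Let prefix_split N j m s : (m <= N)%N ->
  prefix N j m s = \bigcup_(u in [set: 'I_n]) prefix N j m.+1 (upd s m (y u)).
Proof.
move=> mN; apply/seteqP; split => X /=.
  move=> [Xs [XU XN]]; have [u _ yu] := XU m mN.
  exists u => //; split; last by split.
  move=> k /=; rewrite ltnS leq_eqVlt /upd => /predU1P[->|km].
    by rewrite eqxx.
  by rewrite ltn_eqF// Xs.
move=> [u _ [Xs XT]]; split => // k km.
by rewrite Xs ?ltnS ?(ltnW km)// /upd ltn_eqF.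
Qed.

Let prefix_disjoint N j m s (Z : set (trajectory d)) :
  trivIset [set: 'I_n] (fun u => prefix N j m.+1 (upd s m (y u)) `&` Z).
Proof.
move=> u v _ _ [X [[[Xu _] _] [[Xv _] _]]]; apply: y_inj.
by have := Xu m (leqnn _); rewrite (Xv m (leqnn _)) /upd eqxx.
Qed.

(** Induction on the number [r] of free positions; each one is released by summing over its [n]
    possible values. *)
Let prefix_step N j z r s : (r <= N.+1)%N ->
  mu (prefix N j (N.+1 - r) s `&` [set X | X N.+1 = z])
  = (mu (prefix N j (N.+1 - r) s) * (jump w (y j) z)%:E)%E.
Proof.
have mz : measurable [set X : trajectory d | X N.+1 = z].
  exact: (measurable_position N.+1 [set z]).
elim: r s => [|r IH] s rN.
  (* All positions up to [N] are prescribed: either [s] itself is trapped and the Markov property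
     applies, or the event is empty. *)
  rewrite subn0; have [sT|sT] := pselect (trapped N j s).
    have E : prefix N j N.+1 s = [set X | forall k, (k <= N)%N -> X k = s k].
      apply/seteqP; split => X /=; first by case.
      move=> Xs; split => //; split; last by rewrite Xs//; case: sT.
      by move=> k kN; rewrite Xs//; case: sT => /(_ k kN).
    have := proj2 Hmu N s z; case: sT => _ sN; rewrite E sN => <-.
    by [].
  have -> : prefix N j N.+1 s = set0.
    apply/seteqP; split => X //= [Xs [XU XN]]; apply: sT; split.
      by move=> k kN; rewrite -Xs//; exact: XU.
    by rewrite -Xs.
  by rewrite set0I measure0 mul0e.
have mN : (N.+1 - r.+1 <= N)%N by rewrite subSS leq_subr.
have mE : (N.+1 - r.+1).+1 = (N.+1 - r)%N by rewrite subSS subSn.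
rewrite (prefix_split _ _ mN) setI_bigcupl.
have finI : finite_set [set: 'I_n] by exact: finite_finset.
rewrite measure_fin_bigcup//; last first.
  by move=> u _; exact: measurableI.
rewrite measure_fin_bigcup//; last first.
  have := @prefix_disjoint N j (N.+1 - r.+1)%N s setT.
  by under eq_fun do rewrite setIT.
rewrite ge0_mule_fsuml//; apply: eq_fsbigr => u _.
by rewrite mE; apply: IH; exact: ltnW.
Qed.

Let trapped_step N j z :
  mu (trapped N j `&` [set X | X N.+1 = z])
  = (mu (trapped N j) * (jump w (y j) z)%:E)%E.
Proof.
have := @prefix_step N j z N.+1 (fun=> 0) (leqnn _); rewrite subnn.
have -> // : prefix N j 0 (fun=> 0) = trapped N j.
by apply/seteqP; split => X /= => [[]//|]; split.
Qed.

Variable i0 : 'I_n.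
Hypothesis y_i0 : y i0 = 0.

Lemma trapped_occupation N j :
  mu (trapped N j) = (occupation (trap_mx y w) i0 N 0 j)%:E.
Proof.
elim: N j => [|N IH] j /=.
  have m0 : measurable [set X : trajectory d | X 0%N = 0].
    exact: (measurable_position 0%N [set 0]).
  rewrite mxE eqxx /=; have [->|ji] := eqVneq j i0.
    rewrite (_ : trapped 0 i0 = [set X | X 0%N = 0]); first exact: (proj1 Hmu).
    apply/seteqP; split => X /=; rewrite /trapped/= y_i0; first by case.
    move=> X0; split => // k; rewrite leqn0 => /eqP ->.
    by exists i0; rewrite // X0.
  apply/eqP; rewrite -measure_le0.
  have <- : mu (~` [set X | X 0%N = 0]) = 0%E.
    by rewrite probability_setC// (proj1 Hmu) subee.
  apply: le_measure; rewrite ?inE//; [exact: measurable_trapped|exact: measurableC|].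
  move=> X [_ /= ->]; rewrite -y_i0 => /y_inj e.
  by rewrite e eqxx in ji.
rewrite mxE (_ : trapped N.+1 j = \bigcup_(u in [set: 'I_n])
    (trapped N u `&` [set X | X N.+1 = y j])); last first.
  apply/seteqP; split => X /=.
    move=> [XU XN]; have [u _ yu] := XU N (leqnSn N).
    exists u => //; split => //; split => // k kN; apply: XU.
    exact: leqW.
  move=> [u _ [[XU XN] XS]]; split => // k; rewrite leq_eqVlt => /predU1P[->|].
    by rewrite XS; exists j.
  by rewrite ltnS; exact: XU.
have finI : finite_set [set: 'I_n] by exact: finite_finset.
rewrite measure_fin_bigcup//; last 2 first.
- by move=> u v _ _ [X [[[_ Xu] _] [[_ Xv] _]]]; apply: y_inj; rewrite -Xu -Xv.
- move=> u _; apply: measurableI; first exact: measurable_trapped.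
  exact: (measurable_position N.+1 [set y j]).
rewrite (_ : [set: 'I_n] = [set` index_enum 'I_n]); last first.
  by apply/seteqP; split => u //= _; rewrite mem_index_enum.
rewrite -fsbig_seq ?index_enum_uniq// -sumEFin.
apply: eq_bigr => u _; rewrite mxE EFinM -IH.
exact: trapped_step.
Qed.

Lemma le_exit_time X (N : nat) :
  (N%:R%:E <= exit_time (R := R) (range y) X)%E =
  `[< forall k, (k < N)%N -> range y (X k) >].
Proof.
apply/idP/asboolP => [NX k kN|NX].
  apply: contrapT => Xk; have : (exit_time (R := R) (range y) X <= k%:R%:E)%E.
    by apply: ereal_inf_lbound; exists k.
  by move=> /(le_trans NX); rewrite lee_fin ler_nat leqNgt kN.
apply: le_ereal_inf_tmp => _ [k /= Xk <-]; rewrite lee_fin ler_nat leqNgt.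
by apply/negP => kN; apply: Xk; exact: NX.
Qed.

(** The sum includes the exit time, but the walk is then outside the trap while [y x] is inside, so
    that term vanishes. At every visit that counts, [c] takes the value [c (y x)]. *)
Lemma sum_to_exitE (c : lattice d -> R) x X :
  sum_to_exit (range y) X (fun j => ((X j == y x)%:R * c (X j))%R) =
  (\sum_(0 <= N <oo) (c (y x))%:E * (\1_(trapped N x) X)%:E)%E.
Proof.
rewrite /sum_to_exit eseries_mkcond; apply: eq_eseriesr => N _.
rewrite le_exit_time indicE; case: asboolP => XN; last first.
  rewrite memNset ?mule0// => -[XU _]; apply: XN => k kN.
  exact/XU/ltnW.
case: eqVneq => [XNx|XNx].
  rewrite mem_set; first by rewrite mul1r XNx mule1.
  split => // k; rewrite leq_eqVlt => /predU1P[->|]; last exact: XN.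
  by rewrite XNx; exists x.
by rewrite mul0r memNset ?mule0// => -[_]; exact/eqP.
Qed.

Lemma integral_sum_to_exit (c : lattice d -> R) x :
  (\int[mu]_X sum_to_exit (range y) X (fun j => ((X j == y x)%:R * c (X j))%R) =
   (c (y x))%:E *
     \sum_(0 <= N <oo) (occupation (trap_mx y w) i0 N 0 x)%:E)%E.
Proof.
have mT N : measurable_fun setT (fun X => (\1_(trapped N x) X)%:E : \bar R).
  by apply/measurable_EFinP; apply: measurable_indic; exact: measurable_trapped.
have S0 X : (0 <= \sum_(0 <= N <oo) (\1_(trapped N x) X)%:E :> \bar R)%E.
  by apply: nneseries_ge0 => N _ _; rewrite lee_fin.
have IS : (\int[mu]_X (\sum_(0 <= N <oo) (\1_(trapped N x) X)%:E) =
    \sum_(0 <= N <oo) (occupation (trap_mx y w) i0 N 0 x)%:E)%E.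
  rewrite integral_nneseries//.
  apply: eq_eseriesr => N _; rewrite integral_indic//; last exact: measurable_trapped.
  by rewrite setIT; exact: trapped_occupation.
rewrite -IS; transitivity (\int[mu]_X ((c (y x))%:E *
    \sum_(0 <= N <oo) (\1_(trapped N x) X)%:E))%E.
  by apply: eq_integral => X _; rewrite sum_to_exitE nneseriesZ.
have mS : measurable_fun setT
    (fun X => \sum_(0 <= N <oo) (\1_(trapped N x) X)%:E : \bar R)%E.
  by apply: (ge0_emeasurable_sum (h := fun N X => (\1_(trapped N x) X)%:E)
    (P := xpredT)) => //.
have [c0|c0] := leP 0 (c (y x)).
  by rewrite ge0_integralZl// lee_fin.
have Nc0 : 0 <= - c (y x) by rewrite oppr_ge0 ltW.
rewrite -[in LHS](opprK (c (y x))) EFinN.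
under eq_integral do rewrite mulNe.
rewrite integral_ge0N; last by move=> X _; rewrite mule_ge0.
by rewrite ge0_integralZl// EFinN mulNe oppeK.
Qed.

End Trajectories.

(** * Decoupling the environment at one site *)

Section WeightedIntegral.
Local Open Scope ereal_scope.
Context {R : realType}.

Import HBNNSimple.

Section OneMap.
Context d d' (T : measurableType d) (T' : measurableType d').
Variables (m : {measure set T -> \bar R}) (Y : T -> T') (phi : T -> \bar R).
Hypotheses (mY : measurable_fun setT Y) (mphi : measurable_fun setT phi).
Hypothesis phi0 : forall x, 0 <= phi x.
Hypothesis phi_fin : forall x, phi x \is a fin_num.

Lemma integral_weight_nnsfun (h : {nnsfun T' >-> R}) :
  \int[m]_x (phi x * (h (Y x))%:E) =
  \sum_(r \in range h) r%:E * \int[m]_(x in Y @^-1` (h @^-1` [set r])) phi x.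
Proof.
have mYh r : measurable (Y @^-1` (h @^-1` [set r])).
  by rewrite -[X in measurable X]setTI; apply: mY => //; exact: measurable_sfunP.
transitivity (\int[m]_x \sum_(r \in range h)
    r%:E * (phi x * (\1_(Y @^-1` (h @^-1` [set r])) x)%:E)).
  apply: eq_integral => x _; rewrite fimfunE -fsumEFin//.
  rewrite ge0_mule_fsumr; last by move=> r; exact: nnfun_muleindic_ge0.
  by apply: eq_fsbigr => r _; rewrite EFinM muleCA.
have mf r : measurable_fun setT
    (fun x => phi x * (\1_(Y @^-1` (h @^-1` [set r])) x)%:E).
  by apply: emeasurable_funM => //; apply/measurable_EFinP; exact: measurable_indic.
rewrite ge0_integral_fsum//; last 2 first.
- by move=> r; apply: emeasurable_funM.
- move=> r x _; rewrite muleCA mule_ge0//.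
  exact: nnfun_muleindic_ge0 h r (Y x).
apply: eq_fsbigr => r /[!inE] -[z _ <-].
rewrite ge0_integralZl//; last 2 first.
- by move=> x _; rewrite mule_ge0// lee_fin.
- by rewrite lee_fin.
congr (_ * _); rewrite [RHS]integral_mkcond; apply: eq_integral => x _.
by rewrite epatch_indic.
Qed.

Lemma cvg_integral_weight (g : T' -> \bar R) (mg : measurable_fun setT g) :
  (forall y, 0 <= g y) ->
  (\int[m]_x (phi x * (nnsfun_approx measurableT mg n (Y x))%:E) @[n --> \oo]
    --> \int[m]_x (phi x * g (Y x))).
Proof.
move=> g0; set h := nnsfun_approx measurableT mg.
have -> : \int[m]_x (phi x * g (Y x)) =
    \int[m]_x limn (fun n => phi x * (h n (Y x))%:E).
  apply: eq_integral => x _; apply/esym/cvg_lim => //.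
  by apply: cvgeZl => //; exact: cvg_nnsfun_approx.
apply: cvg_monotone_convergence => //.
- move=> n; apply: emeasurable_funM => //; apply/measurable_EFinP.
  exact: measurableT_comp.
- by move=> n x _; rewrite mule_ge0// lee_fin.
- move=> x _ p q pq; rewrite lee_wpmul2l// lee_fin.
  exact/lefP/nd_nnsfun_approx.
Qed.

End OneMap.

(** The hypothesis compares, set by set, the images under [Y1] and [Y2] of the measures with
    densities [phi1] and [phi2]; simple functions and monotone convergence extend it to every
    [g >= 0]. *)
Lemma le_integral_weight d1 d2 d' (T1 : measurableType d1)
    (T2 : measurableType d2) (T' : measurableType d')
    (m1 : {measure set T1 -> \bar R}) (m2 : {measure set T2 -> \bar R})
    (Y1 : T1 -> T') (Y2 : T2 -> T') (phi1 : T1 -> \bar R) (phi2 : T2 -> \bar R)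
    (g : T' -> \bar R) :
  measurable_fun setT Y1 -> measurable_fun setT Y2 ->
  measurable_fun setT phi1 -> measurable_fun setT phi2 ->
  (forall x, 0 <= phi1 x) -> (forall x, 0 <= phi2 x) ->
  (forall x, phi1 x \is a fin_num) -> (forall x, phi2 x \is a fin_num) ->
  (forall B, measurable B -> \int[m1]_(x in Y1 @^-1` B) phi1 x
    <= \int[m2]_(x in Y2 @^-1` B) phi2 x) ->
  measurable_fun setT g -> (forall y, 0 <= g y) ->
  \int[m1]_x (phi1 x * g (Y1 x)) <= \int[m2]_x (phi2 x * g (Y2 x)).
Proof.
move=> mY1 mY2 mphi1 mphi2 phi10 phi20 fin1 fin2 le12 mg g0.
have c1 := cvg_integral_weight (m := m1) mY1 mphi1 phi10 fin1 mg g0.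
have c2 := cvg_integral_weight (m := m2) mY2 mphi2 phi20 fin2 mg g0.
rewrite -(cvg_lim _ c1)// -(cvg_lim _ c2)//; apply: lee_lim.
- by apply/cvg_ex; eexists; exact: c1.
- by apply/cvg_ex; eexists; exact: c2.
apply: nearW => n; rewrite !integral_weight_nnsfun//.
apply: lee_fsum => // r -[y _ <-].
by apply: lee_wpmul2l; [rewrite lee_fin|exact: le12].
Qed.

End WeightedIntegral.

Section Decoupling.
Local Open Scope ereal_scope.
Context {R : realType} d d1 d2 (T : measurableType d)
  (T1 : measurableType d1) (T2 : measurableType d2).
Variables (P : probability T R) (X : T -> T1) (Y : T -> T2).
Hypotheses (mX : measurable_fun setT X) (mY : measurable_fun setT Y).
Variables (phi : T1 -> R) (g : T2 -> \bar R) (c : R).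
Hypotheses (mphi : measurable_fun setT phi) (phi0 : forall x, (0 <= phi x)%R).
Hypothesis phi_fin : \int[P]_x (phi (X x))%:E \is a fin_num.
Hypotheses (mg : measurable_fun setT g) (g0 : forall y, 0 <= g y).
Hypothesis c0 : (0 <= c)%R.

Let mXA A : measurable A -> measurable (X @^-1` A).
Proof. by move=> mA; rewrite -[X in measurable X]setTI; exact: mX. Qed.
Let mYB B : measurable B -> measurable (Y @^-1` B).
Proof. by move=> mB; rewrite -[X in measurable X]setTI; exact: mY. Qed.

Let mphiX : measurable_fun setT (fun x => (phi (X x))%:E).
Proof. by apply/measurable_EFinP; exact: measurableT_comp. Qed.

Let indicE_int A B : measurable A -> measurable B ->
  \int[P]_(x in X @^-1` A) (\1_(Y @^-1` B) x)%:E = P (X @^-1` A `&` Y @^-1` B).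
Proof.
by move=> mA mB; rewrite integral_indic; [rewrite setIC|exact: mXA|exact: mYB].
Qed.

Let phi_restr B : \int[P]_x ((\1_(Y @^-1` B) x)%:E * (phi (X x))%:E) =
  \int[P]_(x in Y @^-1` B) (phi (X x))%:E.
Proof.
rewrite [RHS]integral_mkcond; apply: eq_integral => x _.
by rewrite epatch_indic muleC.
Qed.

Let Zg : \int[P]_x (c%:E * (\int[P]_x (phi (X x))%:E) * g (Y x)) =
  c%:E * (\int[P]_x (phi (X x))%:E) * \int[P]_x g (Y x).
Proof.
rewrite ge0_integralZl//; first exact: measurableT_comp.
by rewrite mule_ge0//; apply: integral_ge0 => x _; rewrite lee_fin.
Qed.

Let Zphi k : 0 <= k -> \int[P]_x (k * (phi (X x))%:E) =
  k * \int[P]_x (phi (X x))%:E.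
Proof. by move=> k0; rewrite ge0_integralZl// => x _; rewrite lee_fin. Qed.

(** Two applications of [le_integral_weight]: the first replaces [g] by indicators of events in [Y],
    the second replaces [phi] by indicators of events in [X], leaving the assumption on rectangles.
    Constant weights encode the product side. *)
Lemma decoupling_ge :
  (forall A B, measurable A -> measurable B ->
    c%:E * P (X @^-1` A) * P (Y @^-1` B) <= P (X @^-1` A `&` Y @^-1` B)) ->
  c%:E * \int[P]_x (phi (X x))%:E * \int[P]_x g (Y x)
    <= \int[P]_x ((phi (X x))%:E * g (Y x)).
Proof.
move=> rect.
have I0 : 0 <= \int[P]_x (phi (X x))%:E by apply: integral_ge0 => x _; rewrite lee_fin.
rewrite -Zg; apply: (le_integral_weight (Y1 := Y) (Y2 := Y) (g := g)
  (phi1 := fun=> c%:E * \int[P]_x (phi (X x))%:E)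
  (phi2 := fun x => (phi (X x))%:E)) => //.
- by move=> _; rewrite mule_ge0.
- by move=> x; rewrite lee_fin.
- by move=> _; rewrite fin_numM.
move=> B mB; rewrite integral_cst; last exact: mYB.
rewrite muleAC -Zphi ?mule_ge0// -phi_restr.
apply: (le_integral_weight (Y1 := X) (Y2 := X) (g := fun x => (phi x)%:E)
  (phi1 := fun=> c%:E * P (Y @^-1` B))
  (phi2 := fun x => (\1_(Y @^-1` B) x)%:E)) => //.
- by apply/measurable_EFinP; apply: measurable_indic; exact: mYB.
- by move=> _; rewrite mule_ge0.
- by move=> _; rewrite fin_numM// fin_num_measure//; exact: mYB.
- move=> A mA; rewrite integral_cst; last exact: mXA.
  by rewrite muleAC indicE_int// rect.
- exact/measurable_EFinP.
Qed.

Lemma decoupling_le :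
  (forall A B, measurable A -> measurable B ->
    P (X @^-1` A `&` Y @^-1` B) <= c%:E * P (X @^-1` A) * P (Y @^-1` B)) ->
  \int[P]_x ((phi (X x))%:E * g (Y x))
    <= c%:E * \int[P]_x (phi (X x))%:E * \int[P]_x g (Y x).
Proof.
move=> rect.
have I0 : 0 <= \int[P]_x (phi (X x))%:E by apply: integral_ge0 => x _; rewrite lee_fin.
rewrite -Zg; apply: (le_integral_weight (Y1 := Y) (Y2 := Y) (g := g)
  (phi2 := fun=> c%:E * \int[P]_x (phi (X x))%:E)
  (phi1 := fun x => (phi (X x))%:E)) => //.
- by move=> x; rewrite lee_fin.
- by move=> _; rewrite mule_ge0.
- by move=> _; rewrite fin_numM.
move=> B mB; rewrite integral_cst; last exact: mYB.
rewrite muleAC -Zphi ?mule_ge0// -phi_restr.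
apply: (le_integral_weight (Y1 := X) (Y2 := X) (g := fun x => (phi x)%:E)
  (phi2 := fun=> c%:E * P (Y @^-1` B))
  (phi1 := fun x => (\1_(Y @^-1` B) x)%:E)) => //.
- by apply/measurable_EFinP; apply: measurable_indic; exact: mYB.
- by move=> _; rewrite mule_ge0.
- by move=> _; rewrite fin_numM// fin_num_measure//; exact: mYB.
- move=> A mA; rewrite integral_cst; last exact: mXA.
  by rewrite muleAC indicE_int// rect.
- exact/measurable_EFinP.
Qed.

End Decoupling.

Section AeSections.
Local Open Scope ereal_scope.
Context d1 d2 (T1 : measurableType d1) (T2 : measurableType d2) (R : realType).
Variable m1 : {sigma_finite_measure set T1 -> \bar R}.
Variable m2 : {sigma_finite_measure set T2 -> \bar R}.

(** By Tonelli, the measures of the sections of a null set integrate to 0, so almost all of them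
    vanish. *)
Lemma ae_product_ysection (P : T1 * T2 -> Prop) :
  {ae m1 \x m2, forall z, P z} ->
  {ae m2, forall v, {ae m1, forall u, P (u, v)}}.
Proof.
move=> [N [mN N0 PN]].
have mS : measurable_fun setT (m1 \o ysection N).
  exact: measurable_fun_ysection.
have /ae_eq_integral_abs : \int[m2]_y `|(m1 \o ysection N) y| = 0.
  under eq_integral do rewrite gee0_abs//.
  rewrite -indic_fubini_tonelli_GE// -indic_fubini_tonelli// -indic_fubini_tonelli1//.
  by rewrite integral_indic// setIT.
move=> /(_ measurableT mS) [M [mM M0 SM]]; exists M; split => //.
apply: subset_trans SM => v /= nP S0; apply: nP.
exists (ysection N v); split; [exact: measurable_ysection|exact: S0|].
by move=> u /= nPu; rewrite /ysection/= inE; exact: PN.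
Qed.

End AeSections.

Lemma ae_nonempty d (T : measurableType d) (R : realType)
    (m : {measure set T -> \bar R}) (P : T -> Prop) :
  m setT != 0%E -> {ae m, forall x, P x} -> exists x, P x.
Proof.
move=> mT [N [mN N0 PN]]; apply: contrapT => nP; case/eqP: mT.
apply/eqP; rewrite -measure_le0 -N0; apply: le_measure; rewrite ?inE//.
by apply: subset_trans PN => x _ /= Px; apply: nP; exists x.
Qed.

(** * From density bounds to bounds on rectangles *)

Section DensityBounds.
Local Open Scope ereal_scope.
Context d (T : measurableType d) (R : realType).
Variables (nu mu : probability T R) (f : T -> \bar R) (A B : R).
Hypotheses (A0 : (0 < A)%R) (numu : nu `<< mu).
Hypothesis fRN : ae_eq mu setT f ('d (charge_of_finite_measure nu) '/d mu).
Hypothesis fAB : {ae mu, forall x, A%:E <= f x /\ f x <= B%:E}.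

Let RN := 'd (charge_of_finite_measure nu) '/d mu.

Let mRN : measurable_fun setT RN.
Proof. by apply: measurable_int; exact: Radon_Nikodym_integrable. Qed.

Let RN_AB : {ae mu, forall x, A%:E <= RN x /\ RN x <= B%:E}.
Proof.
apply: filterS2 fRN fAB => x /(_ Logic.I) e; by rewrite e.
Qed.

Let B0 : (0 <= B)%R.
Proof.
have mT : mu setT != 0 by rewrite probability_setT oner_neq0.
have [x [Ax xB]] := ae_nonempty mT fAB.
by rewrite -lee_fin (le_trans _ (le_trans Ax xB))// lee_fin ltW.
Qed.

(** The derivative is nonnegative only almost everywhere; its positive part represents [nu] as well
    and is nonnegative at every point. *)
Let nuE E : measurable E -> nu E = \int[mu]_(x in E) (RN^\+ x).
Proof.
move=> mE; have -> : nu E = charge_of_finite_measure nu E by [].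
rewrite (@Radon_Nikodym_integral _ _ _ (charge_of_finite_measure nu) mu)//.
apply: ae_eq_integral => //.
- exact: measurable_funTS.
- by apply: measurable_funTS; exact: measurable_funepos.
apply: filterS RN_AB => x [Ax _] _.
by rewrite funeposE; apply/esym/max_idPl; rewrite (le_trans _ Ax)// lee_fin ltW.
Qed.

Lemma density_bounds E : measurable E ->
  A%:E * mu E <= nu E /\ nu E <= B%:E * mu E.
Proof.
move=> mE; have mRNp : measurable_fun E RN^\+.
  by apply: measurable_funTS; exact: measurable_funepos.
rewrite nuE// -!integral_cst//; split; apply: ae_ge0_le_integral => //.
- by move=> x _; rewrite lee_fin ltW.
- by apply: filterS RN_AB => x [Ax _] _; rewrite funeposE le_max Ax.
- by apply: filterS RN_AB => x [_ xB] _; rewrite funeposE ge_max xB lee_fin.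
Qed.

End DensityBounds.

Section Rectangles.
Local Open Scope ereal_scope.
Context {R : realType} {d : nat}.
Variables (P : probability (env R d) R).
Variable Q : env_off0 R d -> probability (prob_row R d) R.
Hypothesis hQ : conditional_law P Q.
Hypothesis hQac : {ae distribution P rows_off0, forall v,
     Q v `<< distribution P row_at0}.
Variable f : prob_row R d * env_off0 R d -> \bar R.
Hypothesis hf : conditional_density P Q f.
Variables (A B : R).
Hypothesis hA : (0 < A)%R.
Hypothesis hAB : {ae (distribution P row_at0 \x distribution P rows_off0)%E,
     forall z, (A%:E <= f z)%E /\ (f z <= B%:E)%E}.

Lemma conditional_law_bounds : {ae distribution P rows_off0, forall v,
  forall E, measurable E -> A%:E * distribution P row_at0 E <= Q v E /\
     Q v E <= B%:E * distribution P row_at0 E}.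
Proof.
have h := ae_product_ysection hAB.
apply: filterS3 hQac (proj2 hf) h => v Qv fv ABv E mE.
exact: density_bounds Qv fv ABv _ mE.
Qed.

(** Independence of the row at the origin from the other rows, up to the factors [A] and [B],
    obtained by integrating the bounds on [Q v E] over [F]. *)
Lemma rectangle_bounds E F : measurable E -> measurable F ->
  A%:E * P (row_at0 @^-1` E) * P (rows_off0 @^-1` F)
    <= P (row_at0 @^-1` E `&` rows_off0 @^-1` F) /\
  P (row_at0 @^-1` E `&` rows_off0 @^-1` F)
    <= B%:E * P (row_at0 @^-1` E) * P (rows_off0 @^-1` F).
Proof.
move=> mE mF; rewrite (proj2 hQ _ _ mE mF).
set mu := distribution P rows_off0.
have -> : P (rows_off0 @^-1` F) = mu F by [].
have -> : P (row_at0 @^-1` E) = distribution P row_at0 E by [].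
have mQ : measurable_fun F (fun v => Q v E).
  by apply: measurable_funTS; exact: (proj1 hQ).
have k0 : 0 <= A%:E * distribution P row_at0 E.
  by rewrite mule_ge0// lee_fin ltW.
(* The sign of [B] comes from a point where [A <= f <= B] holds. *)
have K0 : 0 <= B%:E * distribution P row_at0 E.
  have mT : (distribution P row_at0 \x mu) setT != 0.
    by rewrite probability_setT oner_neq0.
  have [z [Az zB]] := ae_nonempty mT hAB.
  by rewrite mule_ge0// (le_trans _ (le_trans Az zB))// lee_fin ltW.
rewrite -!(integral_cst _ mF); split; apply: ae_ge0_le_integral => //.
- by apply: filterS conditional_law_bounds => v /(_ E mE)[].
- by apply: filterS conditional_law_bounds => v /(_ E mE)[].
Qed.

End Rectangles.

(** * Kalikow's ratio *)

Section Shift.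
Context {R : realType} {d : nat}.
Variable P : probability (env R d) R.

Lemma ge0_integral_env_shift (x : lattice d) (F : env R d -> \bar R) :
  shift_invariant P -> measurable_fun setT F -> (forall w, 0 <= F w)%E ->
  (\int[P]_w F (env_shift x w) = \int[P]_w F w)%E.
Proof.
move=> Pinv mF F0.
have mT := @measurable_env_shift R d x.
rewrite -(@ge0_integral_pushforward _ _ _ _ _ _ mT P setT F)//.
by apply: eq_measure_integral => S mS _; exact: Pinv.
Qed.

End Shift.

(** * Integrability of the drift *)

Section DriftMoments.
Context {R : realType} {d : nat}.
Variables (M kappa : R) (P : probability (env R d) R).
Hypothesis hM : 1 <= M.
Hypothesis Pgood : {ae P, forall w, good_env M kappa w}.

Lemma integral_good_bounded_fin_num (h : env R d -> R) C :
  measurable_fun setT h -> (forall w, 0 <= h w) ->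
  (forall w, good_env M kappa w -> h w <= C) ->
  (\int[P]_w (h w)%:E \is a fin_num)%E.
Proof.
move=> mh h0 hC; rewrite ge0_fin_numE; last first.
  by apply: integral_ge0 => w _; rewrite lee_fin.
apply: (@le_lt_trans _ _ (\int[P]_w (cst `|C|%:E w))%E).
  apply: ae_ge0_le_integral => //.
  - by move=> w _; rewrite lee_fin.
  - exact/measurable_EFinP.
  - by move=> w _; rewrite lee_fin.
  - apply: filterS Pgood => w gw _; rewrite lee_fin.
    exact: le_trans (hC w gw) (ler_norm _).
rewrite integral_cst; last exact: measurableT.
apply: lte_mul_pinfty => //.
exact: (le_lt_trans (probability_le1 P measurableT) (ltry 1)).
Qed.

Variable l : 'rV[R]_d.
Let C := \sum_k (M + M) * `|l ord0 k|.

Let mdrift : measurable_fun setT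
  (fun w : env R d => dot (row_drift (row_at0 w)) l).
Proof.
exact: measurableT_comp (measurable_dot_row_drift l) (@measurable_row_at0 R d).
Qed.

Let max_le_norm (a : R) : `|a| <= C -> Num.max a 0 <= C.
Proof.
by move=> aC; rewrite ge_max (le_trans (ler_norm a) aC) (le_trans (normr_ge0 a) aC).
Qed.

Lemma pos_drift_fin_num :
  (\int[P]_w (Num.max (dot (row_drift (row_at0 w)) l) 0)%:E \is a fin_num)%E.
Proof.
apply: (@integral_good_bounded_fin_num
    (fun w => Num.max (dot (row_drift (row_at0 w)) l) 0) C) => [|w|w gw].
- exact: measurable_maxr.
- by rewrite le_max lexx orbT.
- by apply: max_le_norm; exact: dot_row_drift_le hM gw.
Qed.

Lemma neg_drift_fin_num :
  (\int[P]_w (Num.max (- dot (row_drift (row_at0 w)) l) 0)%:E \is a fin_num)%E.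
Proof.
apply: (@integral_good_bounded_fin_num
    (fun w => Num.max (- dot (row_drift (row_at0 w)) l) 0) C) => [|w|w gw].
- by apply: measurable_maxr => //; exact: measurable_funN.
- by rewrite le_max lexx orbT.
- by apply: max_le_norm; rewrite normrN; exact: dot_row_drift_le hM gw.
Qed.

End DriftMoments.

(** * Ratio estimate for a weight [G] comparable to some [h] that is blind to the row at [x] *)

Section WeightedDrift.
Context {R : realType} {d : nat}.
Variables (kappa A B : R) (k_gt0 : 0 < kappa) (hA : 0 < A) (hB : 0 <= B).
Variable P : probability (env R d) R.
Hypothesis Pinv : shift_invariant P.
Hypothesis rect : forall E F, measurable E -> measurable F ->
  (A%:E * P (row_at0 @^-1` E) * P (rows_off0 @^-1` F)
    <= P (row_at0 @^-1` E `&` rows_off0 @^-1` F))%E /\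
  (P (row_at0 @^-1` E `&` rows_off0 @^-1` F)
    <= B%:E * P (row_at0 @^-1` E) * P (rows_off0 @^-1` F))%E.
Variable phi : prob_row R d -> R.
Hypothesis mphi : measurable_fun setT phi.
Let phip p := Num.max (phi p) 0.
Let phin p := Num.max (- phi p) 0.
Let Ep : \bar R := (\int[P]_w (phip (row_at0 w))%:E)%E.
Let En : \bar R := (\int[P]_w (phin (row_at0 w))%:E)%E.
Hypotheses (Ep_fin : Ep \is a fin_num) (En_fin : En \is a fin_num).
Variables (x : lattice d) (G : env R d -> \bar R) (green h : env R d -> R).
Variable hoff : env_off0 R d -> R.
Hypothesis hE : forall w, h w = hoff (rows_off0 (env_shift x w)).
Hypothesis hoff_ge0 : forall v, 0 <= hoff v.
Hypothesis mhoff : measurable_fun setT hoff.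
Hypotheses (G0 : forall w, (0 <= G w)%E) (mG : measurable_fun setT G).
Hypothesis Gh : {ae P, forall w,
  [/\ G w = (green w)%:E, 0 < green w & kappa * green w <= h w <= green w]}.
Let H : \bar R := (\int[P]_w (h w)%:E)%E.
Hypothesis H_fin : H \is a fin_num.

Let mphip : measurable_fun setT phip.
Proof. exact: measurable_maxr. Qed.
Let mphin : measurable_fun setT phin.
Proof. by apply: measurable_maxr => //; exact: measurable_funN. Qed.
Let phip_ge0 p : 0 <= phip p. Proof. by rewrite /phip le_max lexx orbT. Qed.
Let phin_ge0 p : 0 <= phin p. Proof. by rewrite /phin le_max lexx orbT. Qed.

Let mrow0 : measurable_fun setT (@row_at0 R d). Proof. exact: measurable_row_at0. Qed.
Let moff0 : measurable_fun setT (@rows_off0 R d). Proof. exact: measurable_rows_off0. Qed.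
Let mshift : measurable_fun setT (@env_shift R d x).
Proof. exact: measurable_env_shift. Qed.

Let h_ge0 w : 0 <= h w. Proof. by rewrite hE. Qed.

Let mhoff0 : measurable_fun setT (fun w => hoff (rows_off0 w)).
Proof. exact: measurableT_comp mhoff moff0. Qed.

Let mh : measurable_fun setT h.
Proof.
have -> : h = (fun w => hoff (rows_off0 w)) \o env_shift x.
  by apply/funext => w; rewrite hE.
exact: measurableT_comp mhoff0 mshift.
Qed.

Let HE : H = (\int[P]_w (hoff (rows_off0 w))%:E)%E.
Proof.
rewrite /H -(@ge0_integral_env_shift _ _ P x (fun w => (hoff (rows_off0 w))%:E)) //.
- by apply: eq_integral => w _; rewrite hE.
- exact/measurable_EFinP.
- by move=> w; rewrite lee_fin.
Qed.

(** Otherwise [h] would vanish almost surely, whereas [h] is almost surely at least [kappa * green],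
    which is positive. *)
Let H_gt0 : (0 < H)%E.
Proof.
rewrite lt0e integral_ge0 ?andbT; last by move=> w _; rewrite lee_fin.
apply/eqP => H0.
have /ae_eq_integral_abs : (\int[P]_w `|(h w)%:E| = 0)%E.
  rewrite -H0; apply: eq_integral => w _.
  by apply: gee0_abs; rewrite lee_fin; exact: h_ge0.
have mhE : measurable_fun setT (EFin \o h) by exact/measurable_EFinP.
move=> /(_ measurableT mhE) h_0.
have PT : P setT != 0%E by rewrite probability_setT oner_neq0.
have [w [[_ green_gt0 h_bounds] /(_ Logic.I) hw0]] := ae_nonempty PT (filterI Gh h_0).
have hw : h w = 0 by apply: EFin_inj; exact: hw0.
have /andP[kg _] := h_bounds.
have := lt_le_trans (mulr_gt0 k_gt0 green_gt0) kg.
by rewrite [X in _ < X]hw ltxx.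
Qed.

(** Shift invariance brings the site [x] to the origin, where the rectangle bounds are stated. *)
Let shift_decoupled (psi : prob_row R d -> R) :
  measurable_fun setT psi -> (forall p, 0 <= psi p) ->
  (\int[P]_w ((psi (row_at0 (env_shift x w)))%:E * (h w)%:E) =
   \int[P]_w ((psi (row_at0 w))%:E * (hoff (rows_off0 w))%:E))%E.
Proof.
move=> mpsi psi0.
rewrite -(@ge0_integral_env_shift _ _ P x
  (fun w => (psi (row_at0 w))%:E * (hoff (rows_off0 w))%:E)%E) //.
- by apply: eq_integral => w _; rewrite hE.
- apply: emeasurable_funM; apply/measurable_EFinP => //.
  exact: measurableT_comp mpsi mrow0.
- by move=> w; rewrite mule_ge0// lee_fin.
Qed.

Let mhoffE : measurable_fun setT (fun v => (hoff v)%:E).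
Proof. exact/measurable_EFinP. Qed.

Let hoffE_ge0 v : (0 <= (hoff v)%:E)%E. Proof. by rewrite lee_fin. Qed.

Let pos_part : (A%:E * Ep * H <=
  \int[P]_w ((phip (row_at0 (env_shift x w)))%:E * (h w)%:E))%E.
Proof.
rewrite shift_decoupled// HE.
exact: (decoupling_ge mrow0 moff0 mphip phip_ge0 Ep_fin mhoffE hoffE_ge0
  (ltW hA) (fun E F mE mF => proj1 (rect mE mF))).
Qed.

Let neg_part : (\int[P]_w ((phin (row_at0 (env_shift x w)))%:E * (h w)%:E)
  <= B%:E * En * H)%E.
Proof.
rewrite shift_decoupled// HE.
exact: (decoupling_le mrow0 moff0 mphin phin_ge0 En_fin mhoffE hoffE_ge0
  hB (fun E F mE mF => proj2 (rect mE mF))).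
Qed.

Let Dx w := phi (row_at0 (env_shift x w)).

Let mDx : measurable_fun setT Dx.
Proof. exact: measurableT_comp mphi (measurableT_comp mrow0 mshift). Qed.

(** Since [G] is nonnegative, the integrand has parts [D^+ G] and [D^- G]. The first is bounded
    below using [h <= G], the second above using [G <= kappa^-1 h], and then the decoupled bounds
    apply. *)
Let num_ge : (A%:E * Ep * H - (kappa^-1)%:E * (B%:E * En * H)
  <= \int[P]_w ((Dx w)%:E * G w))%E.
Proof.
have mDG : measurable_fun setT (fun w => (Dx w)%:E * G w)%E.
  by apply: emeasurable_funM => //; exact/measurable_EFinP.
have mrowx : measurable_fun setT (fun w : env R d => row_at0 (env_shift x w)).
  exact: measurableT_comp mrow0 mshift.
rewrite [leRHS]integralE; apply: leeB.
  apply: (le_trans pos_part); apply: ae_ge0_le_integral => //.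
  - by move=> w _; rewrite mule_ge0// lee_fin.
  - apply: emeasurable_funM; apply/measurable_EFinP => //.
    exact: measurableT_comp mphip mrowx.
  - exact: measurable_funepos.
  apply: filterS Gh => w [GE green_gt0 h_bounds] _; rewrite funeposE GE -!EFinM.
  rewrite -EFin_max lee_fin /phip -/(Dx w).
  have /andP[_ hG] := h_bounds; have g0 := ltW green_gt0.
  rewrite -[X in _ <= Num.max _ X](mul0r (green w)) -maxr_pMl//.
  by apply: ler_wpM2l => //; exact: phip_ge0.
apply: (@le_trans _ _ ((kappa^-1)%:E *
    \int[P]_w ((phin (row_at0 (env_shift x w)))%:E * (h w)%:E)))%E; last first.
  by rewrite lee_wpmul2l ?neg_part// lee_fin invr_ge0 ltW.
have mph : measurable_fun setT
    (fun w => (phin (row_at0 (env_shift x w)))%:E * (h w)%:E)%E.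
  apply: emeasurable_funM; apply/measurable_EFinP => //.
  exact: measurableT_comp mphin mrowx.
have ph0 w : (0 <= (phin (row_at0 (env_shift x w)))%:E * (h w)%:E)%E.
  by rewrite mule_ge0// lee_fin.
rewrite -ge0_integralZl//; last by rewrite lee_fin invr_ge0 ltW.
apply: ae_ge0_le_integral => //.
- exact: measurable_funeneg.
- by move=> w _; rewrite mule_ge0// lee_fin invr_ge0 ltW.
- exact: emeasurable_funM.
apply: filterS Gh => w [GE green_gt0 h_bounds] _; rewrite funenegE GE -!EFinM -EFinN.
rewrite -EFin_max lee_fin /phin -/(Dx w).
have /andP[hG _] := h_bounds; have g0 := ltW green_gt0.
rewrite -mulNr -[X in Num.max _ X <= _](mul0r (green w)) -maxr_pMl//.
rewrite mulrCA; apply: ler_wpM2l; first exact: phin_ge0.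
by rewrite mulrC ler_pdivlMr// mulrC.
Qed.

Let den_bounds : (H <= \int[P]_w G w)%E /\ (\int[P]_w G w <= (kappa^-1)%:E * H)%E.
Proof.
have mhE : measurable_fun setT (EFin \o h) by exact/measurable_EFinP.
split.
  apply: ae_ge0_le_integral => //; first by move=> w _; rewrite lee_fin.
  apply: filterS Gh => w [GE green_gt0 h_bounds] _; rewrite GE lee_fin.
  by case/andP: h_bounds.
rewrite -ge0_integralZl//; last 2 first.
- by move=> w _; rewrite lee_fin.
- by rewrite lee_fin invr_ge0 ltW.
apply: ae_ge0_le_integral => //.
- by move=> w _; rewrite mule_ge0// lee_fin// invr_ge0 ltW.
- exact: emeasurable_funM.
apply: filterS Gh => w [GE green_gt0 h_bounds] _; rewrite GE -EFinM lee_fin.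
by rewrite mulrC ler_pdivlMr// mulrC; case/andP: h_bounds.
Qed.


Lemma weighted_drift_ratio_ge : kappa^-1 * B * fine En <= A * fine Ep ->
  ((kappa * (A * fine Ep - kappa^-1 * B * fine En))%:E <=
    (\int[P]_w ((phi (row_at0 (env_shift x w)))%:E * G w)) / \int[P]_w G w)%E.
Proof.
move=> gap.
have [den1 den2] := den_bounds.
have [H1 H2] : H = (fine H)%:E /\ 0 < fine H.
  by rewrite fineK//; split => //; rewrite -lte_fin fineK.
have num := num_ge; move: den1 den2 num.
rewrite -(fineK Ep_fin) -(fineK En_fin) H1 -!EFinM -EFinB.
move: H2; set Hr := fine H; set ep := fine Ep; set en := fine En => Hr0.
have dG0 : (0 <= \int[P]_w G w)%E by exact: integral_ge0.
(* The infinite values are excluded by the upper bound on the denominator and by its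
   nonnegativity. *)
case: (\int[P]_w G w)%E dG0 => [D| |]// _; rewrite !lee_fin => D1 D2 num.
have D0 : 0 < D by exact: lt_le_trans D1.
rewrite inver gt_eqF//.
apply: (@le_trans _ _ ((A * ep * Hr - kappa^-1 * (B * en * Hr))%:E * (D^-1)%:E)%E).
  rewrite -EFinM lee_fin ler_pdivlMr//.
  (* The lower bound on the numerator being nonnegative, the denominator can be replaced by its
     upper bound [kappa^-1 * Hr]. *)
  have e0 : 0 <= A * ep - kappa^-1 * B * en by rewrite subr_ge0.
  apply: (@le_trans _ _ (kappa * (A * ep - kappa^-1 * B * en) * (kappa^-1 * Hr))).
    by apply: ler_wpM2l => //; rewrite mulr_ge0// ltW.
  have -> : kappa * (A * ep - kappa^-1 * B * en) * (kappa^-1 * Hr) =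
     (kappa * kappa^-1) * (A * ep - kappa^-1 * B * en) * Hr by ring.
  rewrite divff ?gt_eqF// mul1r le_eqVlt; apply/orP; left; apply/eqP; ring.
by rewrite lee_wpmul2r// lee_fin invr_ge0 ltW.
Qed.

End WeightedDrift.

Section KalikowRatio.
Context {R : realType} {d : nat}.
Variables (M kappa A B : R).
Hypotheses (hM : 1 <= M) (hkappa : 0 < kappa < 1) (hA : 0 < A) (hB : 0 <= B).
Variable k0 : 'I_d.
Variable P : probability (env R d) R.
Hypothesis Pinv : shift_invariant P.
Hypothesis Pgood : {ae P, forall w, good_env M kappa w}.
Hypothesis rect : forall E F, measurable E -> measurable F ->
  (A%:E * P (row_at0 @^-1` E) * P (rows_off0 @^-1` F)
    <= P (row_at0 @^-1` E `&` rows_off0 @^-1` F))%E /\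
  (P (row_at0 @^-1` E `&` rows_off0 @^-1` F)
    <= B%:E * P (row_at0 @^-1` E) * P (rows_off0 @^-1` F))%E.
Variable P0 : env R d -> probability (trajectory d) R.
Hypothesis hP0 : forall w, quenched_law w 0 (P0 w).
Variable l : 'rV[R]_d.

Let phi (p : prob_row R d) := dot (row_drift p) l.
Let Ep : \bar R := (\int[P]_w (Num.max (phi (row_at0 w)) 0)%:E)%E.
Let En : \bar R := (\int[P]_w (Num.max (- phi (row_at0 w)) 0)%:E)%E.

Variables (n : nat) (y : 'I_n -> lattice d).
Hypothesis y_inj : injective y.
Hypothesis y_conn : M_connected M (range y).
Variables (i0 ix : 'I_n).
Hypothesis y_i0 : y i0 = 0.

Let x := y ix.
(** As a series, it is nonnegative and counts the expected visits in every environment; in good ones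
    it equals the matrix entry [green w]. *)
Let G w : \bar R := (\sum_(0 <= m <oo) (occupation (trap_mx y w) i0 m 0%R ix)%:E)%E.
(** The absolute value secures nonnegativity in all environments and changes nothing in good
    ones. *)
Let gam (A : 'M[R]_n) : R :=
  `|flat_green ix i0 (on_boundary M y ix) (neighbour M y ix) A|.
Let h w := gam (trap_mx y w).
Let hoff (v : env_off0 R d) := gam (trap_mx (fun i => y i - x) (env_of_off0 v)).

(** After recentering, the filler row at the origin affects only row [ix], which [flat_green] does
    not see. *)
Let hE w : h w = hoff (rows_off0 (env_shift x w)).
Proof.
rewrite /h /hoff /gam -(trap_mx_shift y x w); congr `|_|.
apply: flat_green_row => j k jx; rewrite !mxE /jump env_of_off0E//.
by rewrite subr_eq0 (inj_eq y_inj).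
Qed.

Let hoff_ge0 v : 0 <= hoff v. Proof. exact: normr_ge0. Qed.
Let h_ge0 w : 0 <= h w. Proof. exact: normr_ge0. Qed.

Let mhoff : measurable_fun setT hoff.
Proof.
apply: measurableT_comp => //; apply: measurable_flat_green => i j.
exact: measurableT_comp (measurable_trap_mx _ i j) measurable_env_of_off0.
Qed.

Let mh : measurable_fun setT h.
Proof.
apply: measurableT_comp => //; apply: measurable_flat_green => i j.
exact: measurable_trap_mx.
Qed.

Let occ0 (w : env R d) m j : 0 <= occupation (trap_mx y w) i0 m 0 j.
Proof. by apply: occupation_ge0 => *; exact: trap_mx_ge0. Qed.

Let G0 w : (0 <= G w)%E.
Proof. by apply: nneseries_ge0 => m _ _; rewrite lee_fin. Qed.

Let mG : measurable_fun setT G.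
Proof.
apply: (ge0_emeasurable_sum (P := xpredT)
  (h := fun m w => (occupation (trap_mx y w) i0 m 0 ix)%:E)) => [m w _ _|m _].
  by rewrite lee_fin.
apply/measurable_EFinP; apply: measurable_occupation => i j.
exact: measurable_trap_mx.
Qed.

Let green (w : env R d) := invmx (1%:M - trap_mx y w) i0 ix.

Let GE w : good_env M kappa w -> G w = (green w)%:E.
Proof. by move=> gw; exact: (trap_green_series y_inj hM hkappa k0 gw). Qed.

Let green_gt0 w : good_env M kappa w -> 0 < green w.
Proof. by move=> gw; exact: (trap_green_gt0 y_inj hM hkappa k0 gw). Qed.

Let h_bounds w : good_env M kappa w -> kappa * green w <= h w <= green w.
Proof.
move=> gw; have := trap_green_bounds y_inj hM hkappa k0 gw i0 ix.
move=> /= /andP[h1 h2]; rewrite /h /gam ger0_norm ?h1//.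
by rewrite (le_trans _ h1)// mulr_ge0 ?(ltW (green_gt0 gw))//; case/andP: hkappa => /ltW.
Qed.

Let hC w : good_env M kappa w ->
  h w <= lyapunov kappa y k0 i0 / (2 / kappa) ^ Defs.coord (y ix) k0.
Proof.
move=> gw; case/andP: (h_bounds gw) => _ /le_trans; apply.
exact: (trap_green_le y_inj hM hkappa k0 gw).
Qed.

Let H_fin : (\int[P]_w (h w)%:E : \bar R)%E \is a fin_num.
Proof.
have HH := integral_good_bounded_fin_num Pgood mh h_ge0 hC.
exact: HH.
Qed.

Let Gh : {ae P, forall w,
  [/\ G w = (green w)%:E, 0 < green w & kappa * green w <= h w <= green w]}.
Proof.
apply: filterS Pgood => w gw.
split; [exact: GE gw|exact: green_gt0 gw|exact: h_bounds gw].
Qed.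

(** The quenched integrals of numerator and denominator are [G] times the drift at [x] and [G] times
    1, so the ratio has the form treated by [weighted_drift_ratio_ge]. *)
Lemma kalikow_ratio_ge : kappa^-1 * B * fine En <= A * fine Ep ->
  ((kappa * (A * fine Ep - kappa^-1 * B * fine En))%:E
    <= kalikow_ratio P P0 l (range y) (y ix))%E.
Proof.
move=> gap; have k_gt0 : 0 < kappa by case/andP: hkappa.
have -> : kalikow_ratio P P0 l (range y) (y ix) =
    (\int[P]_w ((phi (row_at0 (env_shift x w)))%:E * G w) / \int[P]_w G w)%E.
  congr (_ / _)%E; apply: eq_integral => w _.
    exact: (integral_sum_to_exit (hP0 w) y_inj y_i0
      (fun z => dot (drift (env_shift z w)) l) ix).
  have := integral_sum_to_exit (hP0 w) y_inj y_i0 (fun=> 1) ix.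
  rewrite mul1e => e; rewrite /G -e; apply: eq_integral => X _.
  by congr sum_to_exit; apply/funext => j; rewrite mulr1.
have Ep_fin : Ep \is a fin_num := pos_drift_fin_num hM Pgood l.
have En_fin : En \is a fin_num := neg_drift_fin_num hM Pgood l.
exact: (weighted_drift_ratio_ge k_gt0 hA hB Pinv rect
  (measurable_dot_row_drift l) Ep_fin En_fin hE hoff_ge0 mhoff G0 mG Gh H_fin gap).
Qed.

End KalikowRatio.

(** * From a bound at each trap and site to the infimum in Kalikow's condition *)

Theorem proposition1 (R : realType) (d : nat) (hd : (1 <= d)%N)
  (M : R) (hM : 1 <= M)
  (P : probability (env R d) R)
  (Pinv : shift_invariant P) (Perg : shift_ergodic P)
  (Pfin : finite_range P M)
  (P0 : env R d -> probability (trajectory d) R)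
  (hP0 : forall w, quenched_law w 0 (P0 w))
  (l : 'rV[R]_d) (hl : l != 0)
  (Q : env_off0 R d -> probability (prob_row R d) R)
  (hQ : conditional_law P Q)
  (hQac : {ae distribution P rows_off0, forall v,
     Q v `<< distribution P row_at0})
  (f : prob_row R d * env_off0 R d -> \bar R)
  (hf : conditional_density P Q f)
  (A B : R) (hA : 0 < A)
  (hAB : {ae (distribution P row_at0 \x distribution P rows_off0)%E,
     forall z, (A%:E <= f z)%E /\ (f z <= B%:E)%E})
  (kappa : R) (hkappa : 0 < kappa < 1)
  (Pell : elliptic P M kappa)
  (Hdrift : ('E_P[(fun w => Num.max (dot (drift w) l) 0)%R] >
     (kappa^-1 * B * A^-1)%:E *
     'E_P[(fun w => Num.max (- dot (drift w) l) 0)%R])%E) :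
  kalikow_condition P P0 M l.
Proof.
have hB : 0 <= B.
  have PT : (distribution P row_at0 \x distribution P rows_off0)%E setT != 0%E.
    by rewrite probability_setT oner_neq0.
  have [z [Az zB]] := ae_nonempty PT hAB.
  by rewrite -lee_fin (le_trans _ (le_trans Az zB))// lee_fin ltW.
have Pgood := ae_good_env Pfin Pell.
have rect := rectangle_bounds hQ hQac hf hA hAB.
have k_gt0 : 0 < kappa by case/andP: hkappa.
pose Ep : \bar R := (\int[P]_w (Num.max (dot (row_drift (row_at0 w)) l) 0)%:E)%E.
pose En : \bar R := (\int[P]_w (Num.max (- dot (row_drift (row_at0 w)) l) 0)%:E)%E.
have Ep_fin : Ep \is a fin_num by exact: pos_drift_fin_num hM Pgood l.
have En_fin : En \is a fin_num by exact: neg_drift_fin_num hM Pgood l.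
have drift_gap : kappa^-1 * B * fine En < A * fine Ep.
  have : ((kappa^-1 * B * A^-1 * fine En)%:E < (fine Ep)%:E)%E.
    by rewrite EFinM !fineK//; move: Hdrift; rewrite unlock.
  rewrite lte_fin => gap; rewrite [ltRHS]mulrC -ltr_pdivrMr//.
  by rewrite mulrAC.
(* This positive constant involves neither [U] nor [x], so it bounds both infima from below. *)
apply: (@lt_le_trans _ _ (kappa * (A * fine Ep - kappa^-1 * B * fine En))%:E).
  by rewrite lte_fin mulr_gt0// subr_gt0.
apply: le_ereal_inf_tmp => _ [U [Ufin Uconn U0] <-].
apply: le_ereal_inf_tmp => _ [x Ux <-].
case: (Uconn) => s [sU _].
(* The connecting path may revisit points; removing repetitions gives an injective enumeration of
   [U]. *)
pose t := undup s.
pose y (i : 'I_(size t)) : lattice d := nth 0 t i.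
have mem_t z : U z <-> z \in t by rewrite mem_undup -sU.
have y_inj : injective y.
  move=> i j /eqP; rewrite nth_uniq ?undup_uniq// => /eqP; exact: val_inj.
have y_surj z : U z -> exists i, y i = z.
  move=> /mem_t zt; have it : (index z t < size t)%N by rewrite index_mem.
  by exists (Ordinal it); rewrite /y /= nth_index.
have Uy : range y = U.
  apply/seteqP; split => [_ [i _ <-]|z /y_surj[i yi]]; last by exists i.
  by apply/mem_t; rewrite mem_nth.
have [i0 y0] := y_surj _ U0; have [ix yx] := y_surj _ Ux.
rewrite -Uy -yx; rewrite -Uy in Uconn.
(* [Ordinal hd] is the first coordinate direction, the axis along which the Lyapunov function is
   built. *)
exact: (kalikow_ratio_ge hM hkappa hA hB (Ordinal hd) Pinv Pgood rect hP0
  (l := l) y_inj Uconn ix y0 (ltW drift_gap)).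
Qed.
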